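(* Let $d\in\mathbb N$, $1\le p<\infty$, $1\le v<\infty$, and let $Y_1,Y_2,\dots$ be i.i.d. with law $P_0\in\mathcal P_d$. Suppose $k_n=n^{1/(2v)}$ if $d\le 2v$ and $k_n=n^{1/d}$ if $d>2v$, $K_n=\lceil\log_2k_n\rceil$, $b_n=2^{K_n}$, and that $\alpha_{\mathbf j,b_n}>0$ for every $n\in\mathbb N$ and $\mathbf j\in[b_n]^d$. Let $\gamma>1$ and let constants satisfy $$C_1(d,v)\ge\frac{2^{d/2-v}}{1-2^{d/2-v}}\ (d<2v),\quad C_2(d,v)\ge\frac{2}{d\log 2}\ (d=2v),\quad C_3(d,v)\ge\frac{2^{2(d/2-v)}}{2^{d/2-v}-1}\ (d>2v),$$ and $C_{3+i}(d,v)>\tfrac12 C_i(d,v)^{1/v}2^{1/v}d^{1/p}$ for $i=1,2,3$. Define $$\tau_n(d,v)=\begin{cases} C_4(d,v)\,n^{-1/(2v)}\log^{\gamma/v}(n) & d<2v,\\ C_5(d,v)\,n^{-1/(2v)}\log^{(1+\gamma)/v}(n)& d=2v,\\ C_6(d,v)\,n^{-1/d}\log^{\gamma/v}(n) & d>2v.\end{cases}$$ Then $$\mathbb E_{P_0}\,\Pi_n\big(P\in\mathcal P_d: W_v(P,\bar P_n)\ge\tau_n(d,v)\big)\to0\quad\text{as }n\to\infty.$$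
   Context: The space is $[0,1)^d$ with metric $\|x-y\|_p=(\sum_{i=1}^d|x_i-y_i|^p)^{1/p}$; $\mathcal P_d$ denotes the set of Borel probability measures on $[0,1)^d$. For $\mu,\nu\in\mathcal P_d$, $W_v(\mu,\nu)=\big(\inf_{\pi}\int\|x-y\|_p^v\,d\pi(x,y)\big)^{1/v}$, the infimum over couplings $\pi$ of $\mu$ and $\nu$. For $b\in\mathbb N$ write $[b]=\{1,\dots,b\}$ and, for $\mathbf i=(i_1,\dots,i_d)\in[b]^d$, $A_{\mathbf i,b}=\prod_{l=1}^d\big[\tfrac{i_l-1}{b},\tfrac{i_l}{b}\big)$. For a probability vector $\boldsymbol\pi=(\pi_{\mathbf i})_{\mathbf i\in[b]^d}$, $\psi_b(\boldsymbol\pi)$ is the probability measure with Lebesgue density $\sum_{\mathbf i} b^d\pi_{\mathbf i}\mathbb I(y\in A_{\mathbf i,b})$. Model: $Y_1,\dots,Y_n\mid\boldsymbol\pi\overset{iid}\sim\psi_{b_n}(\boldsymbol\pi)$, $\boldsymbol\pi\sim\mathrm{Dirichlet}((\alpha_{\mathbf i,b_n})_{\mathbf i\in[b_n]^d})$. Posterior concentrations $\alpha^*_{\mathbf i,b_n}=\alpha_{\mathbf i,b_n}+\sum_{t=1}^n\mathbb I(Y_t\in A_{\mathbf i,b_n})$; the posterior $\Pi_n(\cdot\mid Y_1,\dots,Y_n)$ on $\mathcal P_d$ is the law of $\psi_{b_n}(\boldsymbol\pi)$ when $\boldsymbol\pi\sim\mathrm{Dirichlet}((\alpha^*_{\mathbf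 i,b_n})_{\mathbf i})$. The estimator $\bar P_n=\psi_{b_n}\big((\alpha^*_{\mathbf i,b_n}/\sum_{\mathbf j}\alpha^*_{\mathbf j,b_n})_{\mathbf i}\big)$ is the posterior mean histogram. *)

(* Defs.v *)
From HB Require Import structures.
From mathcomp Require Import all_boot all_order all_algebra.
From mathcomp Require Import all_classical all_reals all_analysis.
Set Implicit Arguments. Unset Strict Implicit. Unset Printing Implicit Defensive.
Import Order.TTheory GRing.Theory Num.Theory.
Local Open Scope classical_set_scope.
Local Open Scope ring_scope.

(* Points of R^d are functions 'I_d -> R.  The Borel sigma-algebra of R^d is
   the one generated by the measurable rectangles prod_i B_i. *)
Definition Pt (R : realType) (d : nat) := 'I_d -> R.
HB.instance Definition _ R d := gen_eqMixin (Pt R d).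
HB.instance Definition _ R d := gen_choiceMixin (Pt R d).
HB.instance Definition _ R d := isPointed.Build (Pt R d) (fun _ => 0).

Definition box_sets (R : realType) (d : nat) : set (set (Pt R d)) :=
  [set A | exists B : 'I_d -> set R,
     (forall i, measurable (B i)) /\ A = [set x | forall i, B i (x i)]].

Notation Rd R d := (g_sigma_algebraType (@box_sets R d)).

Definition cube (R : realType) (d : nat) : set ('I_d -> R) :=
  [set x | forall i, 0 <= x i < 1].

(* iterint mu n F = \int mu(dy_1) ... \int mu(dy_n) F [:: y_1; ...; y_n],
   i.e. the integral of F against the n-fold product measure mu^{(x) n}. *)
Fixpoint iterint (R : realType) (dT : measure_display) (T : measurableType dT)
  (mu : set T -> \bar R) (n : nat) (F : seq T -> \bar R) {struct n} : \bar R :=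
  match n with
  | 0 => F [::]
  | n'.+1 => (\int[mu]_y iterint mu n' (fun s => F (y :: s)))%E
  end.

Definition vecpt (R : realType) (d : nat) (s : seq R) : 'I_d -> R :=
  fun i => nth 0 s i.

Definition lebint (R : realType) (d : nat) (f : ('I_d -> R) -> \bar R) : \bar R :=
  iterint (@lebesgue_measure R) d (fun s => f (@vecpt R d s)).

Definition lpdist (R : realType) (d : nat) (p : R) (x y : 'I_d -> R) : R :=
  (\sum_(i < d) `|x i - y i| `^ p) `^ p^-1.

Definition coupling (R : realType) (d : nat) (mu nu : set ('I_d -> R) -> \bar R)
  (pi : probability (Rd R d * Rd R d)%type R) : Prop :=
  forall A : set (Rd R d), measurable A ->
    pi (A `*` setT) = mu A /\ pi (setT `*` A) = nu A.

Definition Wass (R : realType) (d : nat) (p v : R)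
  (mu nu : set ('I_d -> R) -> \bar R) : \bar R :=
  ((ereal_inf [set c | exists pi : probability (Rd R d * Rd R d)%type R,
      coupling mu nu pi /\
      c = (\int[pi]_z ((lpdist p z.1 z.2) `^ v)%:E)%E]) `^ v^-1)%E.

(* cells of the partition of [0,1)^d at resolution b: index j : 'I_d -> 'I_b
   corresponds to the paper's multi-index (j_1+1,...,j_d+1) in [b]^d *)
Definition cell (d b : nat) := {ffun 'I_d -> 'I_b}.

Definition cellset (R : realType) (d b : nat) (j : cell d b) : set ('I_d -> R) :=
  [set y | forall l, (j l)%:R / b%:R <= y l < (j l).+1%:R / b%:R].

Definition psi (R : realType) (d b : nat) (pv : cell d b -> R)
  (A : set ('I_d -> R)) : \bar R :=
  lebint (fun y => (\1_A y * \sum_j (b%:R ^+ d * pv j * \1_(@cellset R d b j) y))%:E).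

(* A probability vector on the cells is parametrized by its first K-1
   coordinates (in the enumeration order of cells), K = #|cell d b|; the last
   coordinate is 1 minus their sum. *)
Definition simplex_pt (R : realType) (d b : nat) (s : seq R) : cell d b -> R :=
  fun j => if (enum_rank j < #|{: cell d b}|.-1)%N then nth 0 s (enum_rank j)
           else 1 - \sum_(x <- s) x.

Definition dir_dens (R : realType) (d b : nat) (a : cell d b -> R) (s : seq R) : R :=
  if all (fun x => 0 < x) s && (\sum_(x <- s) x < 1)
  then \prod_j (@simplex_pt R d b s j) `^ (a j - 1) else 0.

Definition Dirichlet (R : realType) (d b : nat) (a : cell d b -> R)
  (S : set (cell d b -> R)) : R :=
  fine (iterint (@lebesgue_measure R) (#|{: cell d b}|.-1)
          (fun s => (\1_S (@simplex_pt R d b s) * dir_dens a s)%:E)) /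
  fine (iterint (@lebesgue_measure R) (#|{: cell d b}|.-1)
          (fun s => (dir_dens a s)%:E)).

Definition cnt (R : realType) (d b : nat) (j : cell d b) (ys : seq ('I_d -> R)) : nat :=
  count (fun y => `[< @cellset R d b j y >]) ys.

Definition alpha_post (R : realType) (d b : nat) (alpha : cell d b -> R)
  (ys : seq ('I_d -> R)) : cell d b -> R :=
  fun j => alpha j + (cnt j ys)%:R.

Definition post_mean (R : realType) (d b : nat) (alpha : cell d b -> R)
  (ys : seq ('I_d -> R)) : set ('I_d -> R) -> \bar R :=
  psi (fun j => alpha_post alpha ys j / \sum_k alpha_post alpha ys k).

Definition post_prob (R : realType) (d b : nat) (p v : R) (alpha : cell d b -> R)
  (tau : R) (ys : seq ('I_d -> R)) : R :=
  Dirichlet (alpha_post alpha ys)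
    [set pv | (tau%:E <= Wass p v (psi pv) (post_mean alpha ys))%E].

Definition k_n (R : realType) (d : nat) (v : R) (n : nat) : R :=
  if d%:R <= 2 * v then n%:R `^ (2 * v)^-1 else n%:R `^ (d%:R)^-1.

Definition K_n (R : realType) (d : nat) (v : R) (n : nat) : nat :=
  `|Num.ceil (ln (k_n d v n) / ln 2)|%N.

Definition b_n (R : realType) (d : nat) (v : R) (n : nat) : nat :=
  (2 ^ K_n d v n)%N.

Definition tau_n (R : realType) (d : nat) (v gamma C4 C5 C6 : R) (n : nat) : R :=
  if d%:R < 2 * v then C4 * n%:R `^ (- (2 * v)^-1) * (ln n%:R) `^ (gamma / v)
  else if d%:R == 2 * v then C5 * n%:R `^ (- (2 * v)^-1) * (ln n%:R) `^ ((1 + gamma) / v)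
  else C6 * n%:R `^ (- (d%:R)^-1) * (ln n%:R) `^ (gamma / v).

(* Main.v *)
(* The bound holds for every sample [ys] in the cube, so the expectation under
   [P0] is only used through [P0 (cube) = 1].  Write [mu] for a posterior draw and
   [nu] for the posterior mean, both piecewise uniform on the cells of side
   [2^-K].  Interpolate from [nu] to [mu] by the vectors having the masses of [mu]
   on the cells of level [k] and the conditional distributions of [nu] inside them.
   Two consecutive vectors agree on the cells of level [k], so they can be coupled
   at a cost governed by the diameter [d^(1/p) 2^-k] of these cells.  The dyadic
   distance is majorized by a tree metric, for which the couplings can be glued
   additively even after raising to the power [v]; hence, up to constants,
   [W_v^v <= 2^(-vK) + sum_(k < K) 2^(-vk) (V_k + V_(k+1))], where [V_k] is
   controlled by the deviations [mu(A) - nu(A)] over the cells [A] of level [k].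
   The Dirichlet variance of [mu(A)] is at most [nu(A) / n], so [V_k] has mean at
   most [2^(kd/2) / sqrt n].  Summing the geometric series and dividing by
   [tau_n^v] (Markov) leaves a bound of order [1 / ln n].

   The events involved need not be measurable.  Only upper bounds for integrals
   are needed, and the integral of a nonnegative function, being a supremum over
   simple functions, is monotone and superadditive without measurability. *)
Require Import Defs.
From HB Require Import structures.
From mathcomp Require Import all_boot all_order all_algebra.
From mathcomp Require Import all_classical all_reals all_analysis.
From mathcomp Require Import measurable_realfun ring lra.
Set Implicit Arguments. Unset Strict Implicit. Unset Printing Implicit Defensive.
Import Order.TTheory GRing.Theory Num.Theory.
Import numFieldNormedType.Exports.
Local Open Scope classical_set_scope.
Local Open Scope ring_scope.

(** * Iterated integrals *)

Section IteratedIntegral.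
Local Open Scope ereal_scope.
Context {dT : measure_display} {T : measurableType dT} {R : realType}.
Variable mu : {measure set T -> \bar R}.
Implicit Types (f g : T -> \bar R) (F G : seq T -> \bar R).

Import HBNNSimple.

(* The library's [ge0_le_integral] asks for measurable functions. *)
Lemma le_integral_nonmeas f g : (forall x, 0 <= f x) -> (forall x, f x <= g x) ->
  \int[mu]_x f x <= \int[mu]_x g x.
Proof.
move=> f0 fg; have g0 x : 0 <= g x by exact: le_trans (fg x).
rewrite !ge0_integralTE//; apply: le_ereal_sup => _ [h /= hf <-].
by exists h => // x; exact: le_trans (fg x).
Qed.

(** Only [g] is measurable. Every simple function below [f] is measurable, so additivity holds for
    it in place of [f]; the supremum over such functions gives the claim. *)
Lemma integral_superadditive f g : (forall x, 0 <= f x) -> (forall x, 0 <= g x) ->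
  measurable_fun setT g ->
  \int[mu]_x f x + \int[mu]_x g x <= \int[mu]_x (f x + g x).
Proof.
move=> f0 g0 mg.
have key (h : {nnsfun T >-> R}) : (forall x, (h x)%:E <= f x) ->
    sintegral mu h + \int[mu]_x g x <= \int[mu]_x (f x + g x).
  move=> hf.
  have -> : sintegral mu h = \int[mu]_x (h x)%:E.
    by rewrite integral_nnsfun// patch_setT.
  rewrite -ge0_integralD//.
  - apply: le_integral_nonmeas => x; first by rewrite adde_ge0// lee_fin.
    exact: leeD2r.
  - by move=> x _; rewrite lee_fin.
  - exact/measurable_EFinP.
have ig0 : 0 <= \int[mu]_x g x by exact: integral_ge0.
(* Subtracting the integral of [g] requires it to be finite; if it is infinite, [key] at the zero
   function makes the right side infinite. *)
have [gfin|] := boolP (\int[mu]_x g x \is a fin_num); last first.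
  rewrite ge0_fin_numE// -leNgt leye_eq => /eqP gy.
  have := key nnsfun0 (fun x => f0 x).
  rewrite sintegral0 add0e gy leye_eq => /eqP ->.
  exact: leey.
rewrite -leeBrDr// ge0_integralTE//; apply: ge_ereal_sup => _ [h /= hf <-].
by rewrite leeBrDr//; exact: key.
Qed.

(* The integrands of interest come as data on sequences; measurability of the
   successive partial integrals is all that linearity of [iterint] requires. *)
Fixpoint imeas (n : nat) F : Prop :=
  match n with
  | 0 => True
  | n'.+1 => (forall y, imeas n' (fun s => F (y :: s))) /\
      measurable_fun setT (fun y => iterint mu n' (fun s => F (y :: s)))
  end.

Lemma eq_iterint n F G : (forall s, size s = n -> F s = G s) ->
  iterint mu n F = iterint mu n G.
Proof.
elim: n F G => [|n IH] F G FG /=; first exact: FG.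
by apply: eq_integral => y _; apply: IH => s sn; apply: FG; rewrite /= sn.
Qed.

Lemma eq_imeas n F G : (forall s, size s = n -> F s = G s) ->
  imeas n F -> imeas n G.
Proof.
elim: n F G => [//|n IH] F G FG /= [iF mF]; split.
  by move=> y; apply: IH (iF y) => s sn; apply: FG; rewrite /= sn.
rewrite [X in measurable_fun _ X](_ : _ =
  (fun y => iterint mu n (fun s => F (y :: s))))//.
by apply/funext => y; apply: eq_iterint => s sn; rewrite FG//= sn.
Qed.

Lemma iterint_ge0 n F : (forall s, 0 <= F s) -> 0 <= iterint mu n F.
Proof.
elim: n F => [|n IH] F F0 /=; first exact: F0.
by apply: integral_ge0 => y _; exact: IH.
Qed.

Lemma le_iterint n F G : (forall s, 0 <= F s) ->
  (forall s, size s = n -> F s <= G s) -> iterint mu n F <= iterint mu n G.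
Proof.
elim: n F G => [|n IH] F G F0 FG /=; first exact: FG.
apply: le_integral_nonmeas => y; first exact: iterint_ge0.
by apply: IH => // s sn; apply: FG; rewrite /= sn.
Qed.

Lemma iterint0 n : iterint mu n (fun _ => 0) = 0.
Proof.
by elim: n => [//|n IH] /=; under eq_integral do rewrite IH; rewrite integral0.
Qed.

Lemma imeas0 n : imeas n (fun _ => 0).
Proof.
by elim: n => [//|n IH] /=; split => //; rewrite iterint0.
Qed.

Lemma iterintD n F G : (forall s, 0 <= F s) -> (forall s, 0 <= G s) ->
  imeas n F -> imeas n G ->
  iterint mu n (fun s => F s + G s) = iterint mu n F + iterint mu n G.
Proof.
elim: n F G => [//|n IH] F G F0 G0 /= [iF mF] [iG mG].
under eq_integral do rewrite IH//.
by rewrite ge0_integralD// => y _; exact: iterint_ge0.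
Qed.

Lemma imeasD n F G : (forall s, 0 <= F s) -> (forall s, 0 <= G s) ->
  imeas n F -> imeas n G -> imeas n (fun s => F s + G s).
Proof.
elim: n F G => [//|n IH] F G F0 G0 /= [iF mF] [iG mG]; split.
  by move=> y; exact: IH.
rewrite [X in measurable_fun _ X](_ : _ = (fun y =>
  iterint mu n (fun s => F (y :: s)) + iterint mu n (fun s => G (y :: s)))).
  exact: emeasurable_funD.
by apply/funext => y; rewrite iterintD.
Qed.

Lemma iterintZ n F (k : R) : (0 <= k)%R -> (forall s, 0 <= F s) -> imeas n F ->
  iterint mu n (fun s => k%:E * F s) = k%:E * iterint mu n F.
Proof.
elim: n F => [//|n IH] F k0 F0 /= [iF mF].
under eq_integral do rewrite IH//.
by rewrite ge0_integralZl_EFin// => y _; exact: iterint_ge0.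
Qed.

Lemma imeasZ n F (k : R) : (0 <= k)%R -> (forall s, 0 <= F s) -> imeas n F ->
  imeas n (fun s => k%:E * F s).
Proof.
elim: n F => [//|n IH] F k0 F0 /= [iF mF]; split.
  by move=> y; exact: IH.
rewrite [X in measurable_fun _ X](_ : _ = (fun y =>
  k%:E * iterint mu n (fun s => F (y :: s)))).
  exact: measurable_funeM.
by apply/funext => y; rewrite iterintZ.
Qed.

Lemma iterint_sum (I : Type) (r : seq I) n (F : I -> seq T -> \bar R) :
  (forall i s, 0 <= F i s) -> (forall i, imeas n (F i)) ->
  iterint mu n (fun s => \sum_(i <- r) F i s) = \sum_(i <- r) iterint mu n (F i)
  /\ imeas n (fun s => \sum_(i <- r) F i s).
Proof.
move=> F0 iF; elim: r => [|i r [IH1 IH2]].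
  rewrite big_nil; split.
    by under eq_iterint do rewrite big_nil; exact: iterint0.
  by apply: eq_imeas (imeas0 n) => s _; rewrite big_nil.
have S0 s : 0 <= \sum_(j <- r) F j s by apply: sume_ge0.
split.
  under eq_iterint do rewrite big_cons.
  by rewrite iterintD// IH1 big_cons.
apply: eq_imeas (imeasD (F0 i) S0 (iF i) IH2) => s _.
by rewrite big_cons.
Qed.

(** Separates an integrand without measurability, such as the indicator of an arbitrary event, from
    a measurable one. *)
Lemma iterint_superadditive n F G : (forall s, 0 <= F s) -> (forall s, 0 <= G s) ->
  imeas n G ->
  iterint mu n F + iterint mu n G <= iterint mu n (fun s => F s + G s).
Proof.
elim: n F G => [//|n IH] F G F0 G0 /= [iG mG].
apply: le_trans.
  by apply: integral_superadditive => // y; exact: iterint_ge0.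
apply: le_integral_nonmeas => y.
  by rewrite adde_ge0//; exact: iterint_ge0.
exact: IH.
Qed.

End IteratedIntegral.

(** [f] is dominated by the measurable function equal to [B] on [C] and to infinity elsewhere, and
    the complement of [C] is null. *)
Lemma integral_le_of_prob1 {dT : measure_display} {T : measurableType dT} {R : realType}
  (P : probability T R) (C : set T) (B : R) (f : T -> \bar R) :
  measurable C -> P C = 1%E -> (forall y, 0 <= f y)%E ->
  (forall y, C y -> f y <= B%:E)%E -> (\int[P]_y f y <= B%:E)%E.
Proof.
move=> mC PC f0 fB.
have B0 : 0 <= B.
  have [y Cy] : exists y, C y.
    apply: contrapT => nC; have C0 : C = set0.
      by apply/seteqP; split => // y Cy; case: nC; exists y.
    by move: PC; rewrite C0 measure0 => /eqP; rewrite eqe eq_sym oner_eq0.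
  by rewrite -lee_fin; exact: le_trans (f0 y) (fB y Cy).
pose g y : \bar R := if y \in C then B%:E else +oo%E.
have g0 y : (0 <= g y)%E by rewrite /g; case: ifP => // _; rewrite lee_fin.
have PC' : P (~` C) = 0%E by rewrite probability_setC// PC subee.
have mg : measurable_fun setT g.
  apply: measurable_fun_ifT => //; apply: (measurable_fun_bool true).
  rewrite setTI (_ : _ @^-1` _ = C)//.
  by apply/seteqP; split => y; [move=> /set_mem|move=> /mem_set].
apply: (@le_trans _ _ (\int[P]_y g y)%E).
  apply: le_integral_nonmeas => // y.
  by rewrite /g; case: ifPn => [/set_mem/fB//|_]; exact: leey.
rewrite -(setUv C) ge0_integral_setU ?setUv//; last 2 first.
  exact: measurableC.
  exact/disj_setPCl.
rewrite (_ : \int[P]_(x in C) g x = B%:E)%E; last first.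
  under eq_integral => y yC do rewrite /g yC.
  rewrite integral_cst//.
  by have -> : (P : {measure set T -> \bar R}) C = 1%E by []; rewrite mule1.
rewrite (@null_set_integral _ _ _ _ (~` C)) ?adde0//; first exact: measurableC.
exact: measurable_funTS.
Qed.

Lemma iterint_le_of_prob1 {dT : measure_display} {T : measurableType dT} {R : realType}
  (P : probability T R) (C : set T) (B : R) n (F : seq T -> \bar R) :
  measurable C -> P C = 1%E -> (forall s, (0 <= F s)%E) ->
  (forall s, size s = n -> (forall y, List.In y s -> C y) -> (F s <= B%:E)%E) ->
  (iterint P n F <= B%:E)%E.
Proof.
move=> mC PC; elim: n F => [|n IH] F F0 FB /=; first exact: FB.
apply: (integral_le_of_prob1 mC PC) => y; first exact: iterint_ge0.
move=> yC; apply: IH => // s sn sC; apply: FB => [|z [<-//|]]; rewrite /= ?sn//.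
exact: sC.
Qed.

(** * Beta integrals *)

Section Beta.
Context {R : realType}.
Implicit Types a c t x : R.
Local Notation mu := (@lebesgue_measure R).

Lemma is_derive_powR a x : 0 < x ->
  is_derive x 1 (fun y : R => y `^ a) (a * x `^ (a - 1)).
Proof.
move=> x0; have xi : x \in `]0, +oo[ by rewrite in_itv/= andbT.
split; first exact: derivable_powR.
by rewrite -derive1E powR_derive1.
Qed.

Lemma is_derive_powRB a t x : x < t ->
  is_derive x 1 (fun y : R => (t - y) `^ a) (- (a * (t - x) `^ (a - 1))).
Proof.
rewrite -subr_gt0 => /(is_derive_powR a) D1.
have D2 : is_derive x 1 (fun y : R => t - y) (- 1).
  have := is_deriveB (is_derive_cst t x 1) (is_derive_id x 1).
  by rewrite sub0r.
have := @is_derive1_comp R (fun y : R => y `^ a) (fun y => t - y) x _ _ D1 D2.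
by rewrite mulrN1.
Qed.

Lemma is_derive_continuous (f : R -> R) x df : is_derive x 1 f df ->
  {for x, continuous f}.
Proof. by move=> D; apply: differentiable_continuous; apply/derivable1_diffP; case: D. Qed.

Lemma powR_continuous a x : 0 < x -> {for x, continuous (fun y : R => y `^ a)}.
Proof. by move=> x0; exact: is_derive_continuous (is_derive_powR a x0). Qed.

Lemma powRB_continuous a t x : x < t -> {for x, continuous (fun y : R => (t - y) `^ a)}.
Proof. by move=> x0; exact: is_derive_continuous (is_derive_powRB a x0). Qed.

Lemma within_continuous_of_pts (f : R -> R) (a b : R) :
  (forall x, a <= x <= b -> {for x, continuous f}) -> {within `[a, b], continuous f}.
Proof.
move=> h; apply: continuous_in_subspaceT => x /set_mem /=.
by rewrite in_itv/=; exact: h.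
Qed.

Lemma derivable_LR_of_pts (f df : R -> R) (a b : R) : a < b ->
  (forall x, a <= x <= b -> is_derive x 1 f (df x)) ->
  derivable_oo_LRcontinuous f a b /\ {in `]a, b[, f^`()%classic =1 df}.
Proof.
move=> ab D; split; last first.
  move=> x; rewrite in_itv/= => /andP[ax xb].
  have [_ <-] := D x (introT andP (conj (ltW ax) (ltW xb))).
  by rewrite derive1E.
split.
- move=> x; rewrite in_itv/= => /andP[ax xb].
  by have [] := D x (introT andP (conj (ltW ax) (ltW xb))).
- by apply/cvg_at_right_filter/(is_derive_continuous (D a _)); rewrite lexx ltW.
- by apply/cvg_at_left_filter/(is_derive_continuous (D b _)); rewrite lexx ltW.
Qed.

(** Beta integrand on []0, t[], extended by zero to the whole line. The length [t] is kept as a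
    parameter: it will be the mass still available inside a Dirichlet integral. *)
Definition beta_ker a c t x : R :=
  if (0 < x) && (x < t) then x `^ (a - 1) * (t - x) `^ (c - 1) else 0.

Definition beta_int a c t : \bar R := (\int[mu]_x (beta_ker a c t x)%:E)%E.

Lemma beta_ker_ge0 a c t x : 0 <= beta_ker a c t x.
Proof. by rewrite /beta_ker; case: ifP => // _; rewrite mulr_ge0// powR_ge0. Qed.

Lemma beta_int_ge0 a c t : (0 <= beta_int a c t)%E.
Proof. by apply: integral_ge0 => x _; rewrite lee_fin beta_ker_ge0. Qed.

Lemma measurable_beta_ker a c t : measurable_fun setT (beta_ker a c t).
Proof.
apply: measurable_fun_ifT.
- by apply: measurable_and; apply: measurable_fun_ltr.
- apply: measurable_funM; first exact: measurable_powR.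
  apply: (measurableT_comp (measurable_powR _)).
  exact: measurable_funB.
- exact: measurable_cst.
Qed.

(** The factors [x] and [t - x] produced by raising [a] or [c] add up to [t]. *)
Lemma beta_intD a c t : (beta_int (a + 1) c t + beta_int a (c + 1) t =
  t%:E * beta_int a c t)%E.
Proof.
have [t0|t0] := leP t 0.
  have h a' c' : beta_int a' c' t = 0%E.
    apply: integral0_eq => x _; rewrite /beta_ker; case: ifP => // /andP[x0 xt].
    by have := lt_trans x0 xt; rewrite ltNge t0.
  by rewrite !h mule0 adde0.
rewrite /beta_int -ge0_integralZl_EFin//; last 3 first.
- by move=> x _; rewrite lee_fin beta_ker_ge0.
- by apply/measurable_EFinP; exact: measurable_beta_ker.
- exact: ltW.
have k0 a' c' x : setT x -> (0 <= (beta_ker a' c' t x)%:E)%E.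
  by rewrite lee_fin beta_ker_ge0.
have mk a' c' : measurable_fun setT (fun x => (beta_ker a' c' t x)%:E).
  by apply/measurable_EFinP; exact: measurable_beta_ker.
rewrite -(ge0_integralD mu measurableT (k0 _ _) (mk _ _) (k0 _ _) (mk _ _)).
apply: eq_integral => x _; rewrite -EFinD -EFinM; congr (_%:E).
rewrite /beta_ker; case: ifP => [/andP[x0 xt]|]; last by rewrite addr0 mulr0.
have tx : 0 < t - x by rewrite subr_gt0.
have pS (z b : R) : 0 < z -> z `^ (b + 1 - 1) = z * z `^ (b - 1).
  move=> z0; have zn : z != 0 by rewrite gt_eqF.
  have {1}-> : b + 1 - 1 = 1 + (b - 1) by ring.
  by rewrite (@powRD _ z 1 (b - 1)) ?zn ?implybT// powRr1// ltW.
by rewrite !pS//; ring.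
Qed.

(** Change of variable by the dilation of ratio [t]: the kernel is homogeneous of degree [a + c - 2]
    and the Jacobian contributes one more factor [t]. *)
Lemma beta_int_scale a c t : 0 < t ->
  beta_int a c t = ((t `^ (a + c - 1))%:E * beta_int a c 1)%E.
Proof.
move=> t0.
have tn : t != 0 by rewrite gt_eqF.
pose phi0 (x : R) : R := t * x.
pose phi : measurableTypeR R -> measurableTypeR R := phi0.
have mphi : measurable_fun setT phi by exact: mulrl_measurable.
(* Lebesgue measure is [t] times its image under the dilation: checked on intervals, then extended
   by uniqueness. *)
have scaleE (A : set (measurableTypeR R)) : measurable A ->
    mu A = mscale (NngNum (ltW t0)) (pushforward mu phi) A.
  move=> mA; apply: lebesgue_measure_unique => //= _ [[u v]] _ <-.
  rewrite /mscale/= /pushforward/=.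
  rewrite (_ : phi @^-1` _ = `]t^-1 * u, t^-1 * v]%classic); last first.
    by apply/seteqP; split => x /=;
      rewrite /phi /phi0 !in_itv/= ltr_pdivrMl// ler_pdivlMl.
  rewrite !lebesgue_measure_itv/= !lte_fin ltr_pM2l ?invr_gt0//.
  case: ifP => _; last by rewrite mule0.
  by rewrite -!EFinB -EFinM -mulrBr mulrA divff ?mul1r// gt_eqF.
have mk : measurable_fun setT (fun x => (beta_ker a c t x)%:E).
  by apply/measurable_EFinP; exact: measurable_beta_ker.
rewrite /beta_int
  (eq_measure_integral (mscale (NngNum (ltW t0)) (pushforward mu phi))); last first.
  by move=> A mA _; exact: scaleE.
rewrite ge0_integral_mscale//; last by move=> x _; rewrite lee_fin beta_ker_ge0.
have k0 : {in setT, forall y : measurableTypeR R, (0 <= (beta_ker a c t y)%:E)%E}.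
  by move=> y _; rewrite lee_fin beta_ker_ge0.
rewrite (@ge0_integral_pushforward _ _ _ _ R phi mphi mu setT _ measurableT mk k0).
rewrite preimage_setT/=.
have e (x : R) : beta_ker a c t (phi0 x) = t `^ (a + c - 1 - 1) * beta_ker a c 1 x.
  have tx1 : (t * x < t) = (x < 1) by rewrite -{2}[t]mulr1 ltr_pM2l.
  rewrite /beta_ker/phi0 pmulr_rgt0// tx1.
  case: ifP => [/andP[x0 x1]|]; last by rewrite mulr0.
  rewrite -{2}[t]mulr1 -mulrBr !powRM//; [|exact: ltW|by rewrite subr_ge0 ltW|exact: ltW|exact: ltW].
  rewrite (_ : a + c - 1 - 1 = (a - 1) + (c - 1)); last by ring.
  by rewrite (@powRD _ t (a - 1) (c - 1)) ?tn ?implybT//; ring.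
under eq_integral do rewrite /= e EFinM.
rewrite ge0_integralZl_EFin//; last 3 first.
- by move=> x _; rewrite lee_fin beta_ker_ge0.
- by apply/measurable_EFinP; exact: measurable_beta_ker.
- exact: powR_ge0.
rewrite muleA -EFinM/=; congr ((_)%:E * _)%E.
have {2}-> : a + c - 1 = 1 + (a + c - 1 - 1) by ring.
by rewrite (@powRD _ t 1 (a + c - 1 - 1)) ?tn ?implybT// powRr1// ltW.
Qed.

(** Integration by parts on compact intervals increasing to []0, t[], because the integrands may be
    singular at the ends. The boundary terms vanish in the limit, and monotone convergence yields
    the identity in the extended reals. *)
Lemma beta_int_ibp a c t : 0 < a -> 0 < c -> 0 < t ->
  (a%:E * beta_int a (c + 1) t = c%:E * beta_int (a + 1) c t)%E.
Proof.
move=> a0 c0 t0.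
(* The shift by 3 keeps [e n] at most [t / 3], so [[e n, t - e n]] is a proper interval from [n = 0]
   on. *)
pose e (n : nat) : R := t / (n.+3)%:R.
have e0 n : 0 < e n by rewrite divr_gt0// ltr0n.
have e3 n : e n < t - e n.
  have k3 : 3 <= n.+3%:R :> R by rewrite ler_nat.
  have ek : e n * n.+3%:R = t by rewrite divfK// pnatr_eq0.
  by have := e0 n; nra.
have et n : e n < t by apply: lt_trans (e3 n) _; rewrite ltrBlDr ltrDl.
pose F n := `[e n, t - e n]%classic.
pose f1 x := (t - x) `^ c * (a * x `^ (a - 1)).
pose f2 x := c * (t - x) `^ (c - 1) * x `^ a.
pose dl n := (t - (t - e n)) `^ c * (t - e n) `^ a - (t - e n) `^ c * e n `^ a.
have ibp n : (\int[mu]_(x in F n) (f1 x)%:E =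
    (dl n)%:E + \int[mu]_(x in F n) (f2 x)%:E)%E.
  have D1 x : e n <= x <= t - e n ->
      is_derive x 1 (fun y : R => (t - y) `^ c) (- (c * (t - x) `^ (c - 1))).
    move=> /andP[_ xt]; apply: is_derive_powRB; apply: le_lt_trans xt _.
    by rewrite ltrBlDr ltrDl.
  have D2 x : e n <= x <= t - e n ->
      is_derive x 1 (fun y : R => y `^ a) (a * x `^ (a - 1)).
    by move=> /andP[ex _]; apply: is_derive_powR; apply: lt_le_trans ex.
  have [L1 E1] := derivable_LR_of_pts (e3 n) D1.
  have [L2 E2] := derivable_LR_of_pts (e3 n) D2.
  rewrite /f1 (integration_by_parts (e3 n) _ L1 E1 _ L2 E2); last 2 first.
  - apply: within_continuous_of_pts => x /andP[_ xt].
    apply: continuousN; apply: continuousM; first exact: cvg_cst.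
    apply: powRB_continuous; apply: le_lt_trans xt _.
    by rewrite ltrBlDr ltrDl.
  - apply: within_continuous_of_pts => x /andP[ex _].
    apply: continuousM; first exact: cvg_cst.
    by apply: powR_continuous; apply: lt_le_trans ex.
  congr (_ + _)%E.
  under eq_integral do rewrite mulNr EFinN.
  rewrite integral_ge0N ?oppeK// => x _.
  by rewrite lee_fin !mulr_ge0// ?powR_ge0 ?ltW.
have e_0 : e @ \oo --> (0 : R).
  rewrite /e -(mulr0 t); apply: cvgMr.
  rewrite (_ : (fun _ => _) = (fun n => harmonic (n + 2)%N)); last first.
    by apply/funext => n; rewrite /harmonic/= addn2.
  by rewrite (cvg_shiftn 2); exact: cvg_harmonic.
have te : (t - e n) @[n --> \oo] --> t.
  by rewrite -{2}[t]subr0; apply: cvgB => //; exact: cvg_cst.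
have pow0 b : 0 < b -> e n `^ b @[n --> \oo] --> (0 : R).
  move=> b0; have /cvg_at_rightP h := @powR_cvg0 R b b0.
  by apply: h; split.
have powt b : (t - e n) `^ b @[n --> \oo] --> t `^ b.
  exact: (cvg_comp _ _ te (@powR_continuous b t t0)).
have dl0 : dl n @[n --> \oo] --> (0 : R).
  rewrite /dl (_ : 0 = 0 * t `^ a - t `^ c * 0); last by rewrite mul0r mulr0 subrr.
  apply: cvgB; apply: cvgM => //; last exact: pow0.
  by under eq_cvg do rewrite subKr; exact: pow0.
have UF : \bigcup_n F n = [set x : R | 0 < x < t].
  apply/seteqP; split => x /=.
    move=> [n _]; rewrite /F/= in_itv/= => /andP[h1 h2].
    by rewrite (lt_le_trans (e0 n) h1) (le_lt_trans h2)// ltrBlDr ltrDl.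
  move=> /andP[x0 xt].
  have m0 : 0 < Num.min x (t - x) by rewrite lt_min x0 subr_gt0.
  have [N _ /(_ N (leqnn N))] := cvgr_lt 0 e_0 _ m0.
  rewrite /= lt_min => /andP[h1 h2].
  by exists N => //; rewrite /F/= in_itv/= ltW//= lerBrDr -lerBrDl ltW.
have ndF : nondecreasing_seq F.
  move=> m n mn; apply/subsetPset => x; rewrite /F/= !in_itv/= => /andP[h1 h2].
  have enm : e n <= e m by rewrite ler_pM2l// lef_pV2 ?posrE ?ltr0n// ler_nat.
  by rewrite (le_trans enm)//= (le_trans h2)// lerB.
have limF (f : R -> R) : (forall x, 0 <= f x) -> measurable_fun setT f ->
    (\int[mu]_(x in F n) (f x)%:E @[n --> \oo] -->
     \int[mu]_(x in [set x : R | (0 < x < t)%R]) (f x)%:E)%E.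
  move=> f0 mf; rewrite -UF; apply: ge0_nondecreasing_set_cvg_integral => //.
  - by move=> n; exact: measurable_itv.
  - by move=> n; apply/measurable_EFinP; exact: measurable_funTS.
  - by move=> n x _; rewrite lee_fin.
have mt b : measurable_fun setT (fun x : R => (t - x) `^ b).
  by apply: (measurableT_comp (measurable_powR _)); exact: measurable_funB.
have mf1 : measurable_fun setT f1.
  by apply: measurable_funM => //; apply: measurable_funM => //; exact: measurable_powR.
have mf2 : measurable_fun setT f2.
  by apply: measurable_funM; [exact: measurable_funM|exact: measurable_powR].
have f10 x : 0 <= f1 x by rewrite !mulr_ge0// ?powR_ge0 ?ltW.
have f20 x : 0 <= f2 x by rewrite !mulr_ge0// ?powR_ge0 ?ltW.
have mI : measurable [set x : R | 0 < x < t].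
  exact: (measurable_itv `]0, t[).
have toI (f : R -> R) (a' c' k : R) : 0 <= k ->
    (forall x, 0 < x < t -> f x = k * (x `^ (a' - 1) * (t - x) `^ (c' - 1))) ->
    (\int[mu]_(x in [set x : R | (0 < x < t)%R]) (f x)%:E = k%:E * beta_int a' c' t)%E.
  move=> k0 fE; rewrite /beta_int -ge0_integralZl_EFin//; last 2 first.
  - by move=> x _; rewrite lee_fin beta_ker_ge0.
  - by apply/measurable_EFinP; exact: measurable_beta_ker.
  rewrite [LHS]integral_mkcond; apply: eq_integral => x _.
  rewrite patchE -EFinM /beta_ker; case: ifPn => [/set_mem/= h|/negP h].
    by rewrite h fE.
  by case: ifP => [h'|_]; [exfalso; apply: h; exact: mem_set|rewrite mulr0].
have l1 := limF f1 f10 mf1; have l2 := limF f2 f20 mf2.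
have l3 : ((dl n)%:E + \int[mu]_(x in F n) (f2 x)%:E @[n --> \oo] -->
     0 + \int[mu]_(x in [set x : R | (0 < x < t)%R]) (f2 x)%:E)%E.
  apply: cvgeD => //; apply: cvg_EFin => //; exact: nearW.
rewrite (_ : (fun n => _) = (fun n => (dl n)%:E + \int[mu]_(x in F n) (f2 x)%:E)%E) in l1;
  last by apply/funext.
have t1 := toI f1 a (c + 1) a (ltW a0)
  (fun x _ => ltac:(by rewrite /f1 addrK; ring)).
have t2 := toI f2 (a + 1) c c (ltW c0)
  (fun x _ => ltac:(by rewrite /f2 addrK; ring)).
rewrite -t1 -t2 -[RHS]add0e.
exact: (cvg_unique _ l1 l3).
Qed.

(** [beta_intD] and [beta_int_ibp] are two linear equations in the two unknowns, which are finite
    because [t * beta_int a c t] is. *)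
Lemma beta_int_succ a c t : 0 < a -> 0 < c -> 0 < t ->
  beta_int a c t \is a fin_num ->
  (beta_int (a + 1) c t = (a / (a + c) * t)%:E * beta_int a c t /\
   beta_int a (c + 1) t = (c / (a + c) * t)%:E * beta_int a c t)%E.
Proof.
move=> a0 c0 t0; have := beta_int_ibp a0 c0 t0; have := beta_intD a c t.
have := beta_int_ge0 (a + 1) c t; have := beta_int_ge0 a (c + 1) t.
case: (beta_int a c t) => [B| |]//; case: (beta_int (a + 1) c t) => [B1| |]//;
  case: (beta_int a (c + 1) t) => [B2| |]// _ _.
rewrite -!EFinM -!EFinD => -[e1] [e2] _.
have ac : a + c != 0 by rewrite gt_eqF// addr_gt0.
split; congr (_%:E); apply: (mulfI ac).
  rewrite (_ : (a + c) * (a / (a + c) * t * B) = a * (t * B)); last by field.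
  by rewrite -e1 mulrDl mulrDr e2 [LHS]addrC addrC.
rewrite (_ : (a + c) * (c / (a + c) * t * B) = c * (t * B)); last by field.
by rewrite -e1 mulrDl mulrDr e2.
Qed.

End Beta.

(** * Dirichlet distributions *)

Section DirichletNormalizer.
Context {R : realType}.
Local Notation mu := (@lebesgue_measure R).

(** Unnormalized Dirichlet density on the simplex of total mass [t]: each coordinate takes its share
    from [t], and the last one, absent from [s], receives the remainder. The recursion follows that
    of [iterint]. *)
Fixpoint dir_ker (l : seq R) (t : R) (s : seq R) : R :=
  match l with
  | [::] => 0
  | b :: l' =>
    if nilp l' then (if 0 < t then t `^ (b - 1) else 0)
    else match s with
         | [::] => 0
         | y :: s' => if 0 < y then y `^ (b - 1) * dir_ker l' (t - y) s' else 0
         end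
  end.

(** The multivariate Beta function, as a product of Beta integrals that split each coordinate from
    the following ones. *)
Fixpoint dir_const (l : seq R) : \bar R :=
  match l with
  | [::] => 1%E
  | b :: l' =>
    if nilp l' then 1%E
    else (beta_int b (\sum_(x <- l') x) 1 * dir_const l')%E
  end.

Lemma dir_const_ge0 l : (0 <= dir_const l)%E.
Proof.
elim: l => [|b l IH] /=; first exact: lee01.
by case: ifP => _; [exact: lee01|rewrite mule_ge0// beta_int_ge0].
Qed.

Lemma dir_ker_ge0 l t s : 0 <= dir_ker l t s.
Proof.
elim: l t s => [//|b l IH] t s /=; case: ifP => _.
  by case: ifP => // _; exact: powR_ge0.
by case: s => // y s; case: ifP => // _; rewrite mulr_ge0// powR_ge0.
Qed.

(** With the first coordinate [y] fixed, induction evaluates the inner integral as a constant times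
    a power of [t - y], so the outer integral is a Beta integral. *)
Lemma iterint_dir_ker l t : l != [::] ->
  iterint mu (size l).-1 (fun s => (dir_ker l t s)%:E) =
    (if (0 < t)%R then (t `^ (\sum_(x <- l) x - 1))%R%:E * dir_const l else 0%E)%E
  /\ imeas mu (size l).-1 (fun s => (dir_ker l t s)%:E).
Proof.
elim: l t => [//|b l IH] t _.
case: l IH => [|b' l'] IH.
  by split => //=; rewrite big_seq1 mule1; case: ifP.
move: (b' :: l') (IH) => {b' l'} l {}IH' {IH}.
have [->|l0] := eqVneq l [::].
  by split => //=; rewrite big_seq1 mule1; case: ifP.
have IH u : _ := IH' u l0 => {IH'}.
have ln : nilp l = false by apply/negbTE; case: l l0 {IH}.
have -> : (size (b :: l)).-1 = (size l).-1.+1 by case: l l0 {IH ln}.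
set c := \sum_(x <- l) x.
have inner y : iterint mu (size l).-1 (fun s => (dir_ker (b :: l) t (y :: s))%:E) =
    ((beta_ker b c t y)%:E * dir_const l)%E /\
    imeas mu (size l).-1 (fun s => (dir_ker (b :: l) t (y :: s))%:E).
  rewrite /= ln /beta_ker; have [y0|y0] /= := boolP (0 < y); last first.
    by rewrite iterint0 mul0e; split => //; exact: imeas0.
  have [I1 I2] := IH (t - y).
  split.
    under eq_iterint do rewrite EFinM.
    rewrite iterintZ ?powR_ge0//; last by move=> s; rewrite lee_fin dir_ker_ge0.
    rewrite I1 subr_gt0; case: ifP => _; last by rewrite mule0 mul0e.
    by rewrite muleA EFinM.
  have k0 s : (0 <= (dir_ker l (t - y) s)%:E)%E by rewrite lee_fin dir_ker_ge0.
  have := @imeasZ _ _ _ mu _ _ (y `^ (b - 1)) (powR_ge0 _ _) k0 I2.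
  by apply: eq_imeas => s _; rewrite EFinM.
have mk : measurable_fun setT (fun y => (beta_ker b c t y)%:E).
  by apply/measurable_EFinP; exact: measurable_beta_ker.
have ifunE : (fun y => iterint mu (size l).-1
    (fun s => (dir_ker (b :: l) t (y :: s))%:E)) =
    (fun y => (beta_ker b c t y)%:E * dir_const l)%E.
  by apply/funext => y; case: (inner y).
split; last first.
  split; first by move=> y; case: (inner y).
  rewrite ifunE; under eq_fun do rewrite muleC; exact: measurable_funeM.
rewrite [LHS]/iterint -/(@iterint _ _ _ _) ifunE.
rewrite ge0_integralZr//; last 2 first.
- by move=> x _; rewrite lee_fin beta_ker_ge0.
- exact: dir_const_ge0.
rewrite -/(beta_int b c t); case: ifP => [t0|/negbT].
  by rewrite beta_int_scale// big_cons -/c /= ln muleA.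
rewrite -leNgt => t0; rewrite /beta_int integral0_eq ?mul0e// => x _.
rewrite /beta_ker; case: ifP => // /andP[x0 xt].
by have := lt_trans x0 xt; rewrite ltNge t0.
Qed.

Lemma mule_fin_ne0 (x y : \bar R) : (0 <= x)%E -> (0 <= y)%E ->
  (x * y)%E \is a fin_num -> (x * y != 0)%E ->
  [/\ x \is a fin_num, y \is a fin_num & (y != 0)%E].
Proof.
move=> x0 y0 xyf xyn.
have xn : x != 0%E by apply: contraNneq xyn => ->; rewrite mul0e.
have yn : y != 0%E by apply: contraNneq xyn => ->; rewrite mule0.
have xp : (0 < x)%E by rewrite lt0e xn.
have yp : (0 < y)%E by rewrite lt0e yn.
split => //.
- by case: x x0 xp xyf {xn xyn} => // _ _; rewrite gt0_mulye.
- by case: y y0 yp xyf {yn xyn} => // _ _; rewrite gt0_muley.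
Qed.

(** Raising [a i] multiplies the factor splitting off [i] by [a i] over the sum from [i] on, and
    every earlier factor by a ratio of consecutive tail sums; the product telescopes. *)
Lemma dir_const_succ (I : eqType) (r : seq I) (a : I -> R) i :
  uniq r -> i \in r -> (forall j, 0 < a j) ->
  dir_const (map a r) \is a fin_num -> dir_const (map a r) != 0%E ->
  dir_const [seq a j + (j == i)%:R | j <- r] =
    ((a i / \sum_(j <- r) a j)%:E * dir_const (map a r))%E.
Proof.
move=> + + a0; elim: r => [//|j r IH] /= /andP[jr ur].
have [->|rn] := eqVneq r [::].
  rewrite inE => /eqP -> _ _ /=; rewrite big_seq1 divff ?mul1e//.
  by rewrite gt_eqF.
have mn (f : I -> R) : nilp (map f r) = false by apply/negbTE; case: r rn {IH jr ur}.
rewrite !mn !big_map => ir fin ne0.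
have [f1 f2 n2] := mule_fin_ne0 (beta_int_ge0 _ _ _) (dir_const_ge0 _) fin ne0.
have s0 : 0 < \sum_(k <- r) a k.
  case: r rn {IH jr ur ir fin ne0 mn f1 f2 n2} => [//|k r] _.
  by rewrite big_cons ltr_wpDr// sumr_ge0// => m _; exact: ltW.
have [b1 b2] := beta_int_succ (a0 j) s0 ltr01 f1.
have sn : \sum_(k <- r) a k != 0 by rewrite gt_eqF.
have asn : a j + \sum_(k <- r) a k != 0 by rewrite gt_eqF// addr_gt0.
rewrite big_cons.
move: ir; rewrite inE => /predU1P[eij|ir].
  rewrite eij.
  have e : {in r, forall k, a k + (k == j)%:R = a k}.
    by move=> k kr; case: eqP => [kj|_]; [rewrite kj (negbTE jr) in kr|rewrite addr0].
  rewrite eqxx (_ : [seq _ | k <- r] = map a r); last exact/eq_in_map.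
  rewrite (eq_big_seq _ e).
  by rewrite b1 mulr1 muleA.
have -> : (j == i) = false by apply/negbTE; apply: contraNneq jr => ->.
rewrite addr0 IH// big_split/=.
rewrite (_ : \sum_(k <- r) (k == i)%:R = 1); last first.
  by rewrite (bigD1_seq i)//= eqxx big1 ?addr0// => k /negbTE ->.
rewrite b2 mulr1 -(fineK f1) -(fineK f2) -!EFinM; congr (_%:E).
by field; rewrite sn asn.
Qed.

End DirichletNormalizer.

Lemma dir_ker_rcons (R : realType) (l : seq R) (c t : R) (s : seq R) :
  size s = size l ->
  dir_ker (rcons l c) t s =
  if all (fun x => 0 < x) s && (\sum_(x <- s) x < t)
  then (\prod_(i < size l) s`_i `^ (l`_i - 1)) * (t - \sum_(x <- s) x) `^ (c - 1)
  else 0.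
Proof.
elim: l t s => [|b l IH] t [|y s]//=.
  by rewrite !big_nil big_ord0 mul1r subr0.
move=> [ss]; rewrite (_ : nilp (rcons l c) = false); last by case: l {IH ss}.
rewrite big_cons; case: ifP => [y0|]//=.
rewrite IH// ltrBrDl opprD addrA; case: ifP; last by rewrite mulr0.
by rewrite big_ord_recl/= mulrA.
Qed.

(** * Second moments of the Dirichlet distribution *)

Section DirichletMoments.
Context {R : realType} {d b : nat}.
Hypothesis b0 : (0 < b)%N.
Local Notation mu := (@lebesgue_measure R).
Local Notation spt := (@simplex_pt R d b).
Local Notation N := #|{: cell d b}|.
Implicit Types (a : cell d b -> R) (s : seq R).

Let N0 : (0 < N)%N.
Proof. by apply/card_gt0P; exists [ffun => Ordinal b0]. Qed.

Let NS : N = N.-1.+1.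
Proof. by rewrite prednK. Qed.

Lemma simplex_ptE s j : size s = N.-1 ->
  spt s j = nth 0 (rcons s (1 - \sum_(x <- s) x)) (enum_rank j).
Proof.
move=> sN; rewrite /simplex_pt nth_rcons sN; case: ltnP => // jN.
have := ltn_ord (enum_rank j); rewrite [X in (_ < X)%N]NS ltnS => jN'.
by rewrite eqn_leq jN jN'.
Qed.

Lemma sum_simplex_pt s : size s = N.-1 -> \sum_j spt s j = 1.
Proof.
move=> sN; transitivity (\sum_(x <- rcons s (1 - \sum_(x <- s) x)) x).
  rewrite (big_nth 0) size_rcons sN -NS big_mkord.
  rewrite (reindex (@enum_rank (cell d b))); last exact/onW_bij/enum_rank_bij.
  by apply: eq_bigr => j _; rewrite simplex_ptE.
by rewrite -cats1 big_cat big_seq1/= addrC subrK.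
Qed.

Lemma simplex_pt_gt0 s j : size s = N.-1 ->
  all (fun x => 0 < x) s && (\sum_(x <- s) x < 1) -> 0 < spt s j.
Proof.
move=> sN /andP[/allP s0 s1]; rewrite simplex_ptE//.
have : nth 0 (rcons s (1 - \sum_(x <- s) x)) (enum_rank j) \in
    rcons s (1 - \sum_(x <- s) x).
  by apply: mem_nth; rewrite size_rcons sN -NS ltn_ord.
by rewrite mem_rcons inE => /predU1P[->|/s0//]; rewrite subr_gt0.
Qed.

(** In the enumeration order of the cells the dependent coordinate comes last, so splitting the last
    parameter off with [rcons] matches the two forms of the density. *)
Lemma dir_densE a s : size s = N.-1 ->
  dir_dens a s = dir_ker (map a (enum {: cell d b})) 1 s.
Proof.
move=> sN; set l := map a _.
have sl : size l = N by rewrite size_map -cardE.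
have [l' [c lE]] : exists l' c, l = rcons l' c.
  case/lastP: l sl => [|l' c _]; last by exists l', c.
  by move=> /esym/eqP; rewrite NS.
move: sl; rewrite lE size_rcons NS => -[sl].
rewrite dir_ker_rcons ?sN ?sl// /dir_dens; case: ifP => // _.
transitivity (\prod_(i < N)
    nth 0 (rcons s (1 - \sum_(x <- s) x)) i `^ (nth 0 (rcons l' c) i - 1)).
  rewrite (reindex (@enum_rank (cell d b))); last exact/onW_bij/enum_rank_bij.
  apply: eq_bigr => j _; rewrite simplex_ptE// -lE (nth_map j) ?nth_enum_rank//.
  by rewrite -cardE ltn_ord.
rewrite -(big_mkord xpredT (fun i => nth 0 (rcons s _) i `^ (nth 0 (rcons l' c) i - 1))).
rewrite NS big_nat_recr//= big_mkord !nth_rcons sN sl ltnn eqxx; congr (_ * _).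
by apply: eq_bigr => i _; rewrite !nth_rcons sN sl ltn_ord.
Qed.

Lemma dir_dens_ge0 a s : 0 <= dir_dens a s.
Proof.
rewrite /dir_dens; case: ifP => // _.
by apply: prodr_ge0 => j _; exact: powR_ge0.
Qed.

(** Multiplying by a coordinate raises its exponent; hence moments of the Dirichlet law are ratios
    of normalizers. *)
Lemma dir_dens_succ a i s : size s = N.-1 ->
  dir_dens (fun j => a j + (j == i)%:R) s = spt s i * dir_dens a s.
Proof.
move=> sN; rewrite /dir_dens; case: ifP => [h|]; last by rewrite mulr0.
have x0 j : 0 < spt s j := simplex_pt_gt0 j sN h.
rewrite (bigD1 i)//= [in RHS](bigD1 i)//= mulrA; congr (_ * _); last first.
  by apply: eq_bigr => j /negbTE ->; rewrite addr0.
have xn : spt s i != 0 by rewrite gt_eqF.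
rewrite eqxx {1}(_ : a i + 1 - 1 = 1 + (a i - 1)); last by ring.
by rewrite (@powRD _ _ 1 (a i - 1)) ?xn ?implybT// powRr1// ltW.
Qed.

Definition dir_norm a : \bar R := iterint mu N.-1 (fun s => (dir_dens a s)%:E).

Lemma imeas_dir_dens a : imeas mu N.-1 (fun s => (dir_dens a s)%:E).
Proof.
have l0 : map a (enum {: cell d b}) != [::].
  by rewrite -size_eq0 size_map -cardE -lt0n.
have [_] := iterint_dir_ker 1 l0; rewrite size_map -cardE.
by apply: eq_imeas => s sN; rewrite dir_densE.
Qed.

Lemma dir_norm_const a : dir_norm a = dir_const (map a (enum {: cell d b})).
Proof.
have l0 : map a (enum {: cell d b}) != [::].
  by rewrite -size_eq0 size_map -cardE -lt0n.
have [+ _] := iterint_dir_ker 1 l0; rewrite size_map -cardE ltr01 powR1 mul1e => <-.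
by apply: eq_iterint => s sN; rewrite dir_densE.
Qed.

Lemma dir_norm_succ a i : (forall j, 0 < a j) ->
  dir_norm a \is a fin_num -> dir_norm a != 0%E ->
  dir_norm (fun j => a j + (j == i)%:R) = ((a i / \sum_j a j)%:E * dir_norm a)%E.
Proof.
move=> a0; rewrite !dir_norm_const => f n.
by rewrite dir_const_succ ?enum_uniq ?mem_enum// big_enum.
Qed.

(** The known mean of the product of coordinates [i] and [j] of a Dirichlet vector. *)
Definition dir_moment2 a i j : R :=
  a i / (\sum_k a k) * ((a j + (j == i)%:R) / (1 + \sum_k a k)).

Lemma dir_norm_succ2 a i j : (forall j, 0 < a j) ->
  dir_norm a \is a fin_num -> dir_norm a != 0%E ->
  dir_norm (fun k => a k + (k == i)%:R + (k == j)%:R) =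
  ((dir_moment2 a i j)%:E * dir_norm a)%E.
Proof.
move=> a0 f n.
have s0 : 0 < \sum_k a k.
  have j0 : cell d b := [ffun => Ordinal b0].
  by rewrite (bigD1 j0)//= ltr_wpDr// sumr_ge0// => m _; exact: ltW.
have e := dir_norm_succ i a0 f n.
have ap k : 0 < a k + (k == i)%:R by rewrite ltr_wpDr// ler0n.
rewrite (dir_norm_succ (a := fun k => a k + (k == i)%:R))//.
- rewrite e muleA -EFinM big_split/= (_ : \sum_k (k == i)%:R = 1); last first.
    by rewrite (bigD1 i)//= eqxx big1 ?addr0// => k /negbTE ->.
  by rewrite /dir_moment2 mulrC [1 + _]addrC.
- by rewrite e fin_numM.
- by rewrite e mule_eq0 negb_or n andbT eqe mulf_neq0// ?invr_eq0 gt_eqF.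
Qed.

(* If the normalizer is 0 or infinite then [Dirichlet a S = 0] by the
   conventions [fine +oo = 0] and [x / 0 = 0]. *)
Lemma Dirichlet_le_quad a (m : cell d b -> cell d b -> R) (S : set (cell d b -> R)) :
  (forall j, 0 < a j) ->
  (forall x, (forall j, 0 < x j) -> \sum_j x j = 1 ->
     0 <= \sum_i \sum_j m i j * (x i * x j)) ->
  (forall x, (forall j, 0 < x j) -> \sum_j x j = 1 -> S x ->
     1 <= \sum_i \sum_j m i j * (x i * x j)) ->
  0 <= \sum_i \sum_j m i j * dir_moment2 a i j ->
  Dirichlet a S <= \sum_i \sum_j m i j * dir_moment2 a i j.
Proof.
move=> a0 m0 m1 M0; rewrite /Dirichlet -/(dir_norm a).
have [->|Zn] := eqVneq (fine (dir_norm a)) 0; first by rewrite invr0 mulr0.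
have Zf : dir_norm a \is a fin_num.
  by move: Zn; case: (dir_norm a) => //=; rewrite eqxx.
have Zn0 : dir_norm a != 0%E by apply: contraNneq Zn => ->.
have Z0 : (0 <= dir_norm a)%E by apply: iterint_ge0 => s; rewrite lee_fin dir_dens_ge0.
have Zp : 0 < fine (dir_norm a) by rewrite lt0r Zn fine_ge0.
set F := fun s => (\1_S (spt s) * dir_dens a s)%:E.
have F0 s : (0 <= F s)%E by rewrite lee_fin mulr_ge0// dir_dens_ge0.
pose a2 i j := (fun k => a k + (k == i)%:R + (k == j)%:R) : cell d b -> R.
pose Q (w : cell d b -> cell d b -> R) s : \bar R :=
  (\sum_(i : cell d b) \sum_(j : cell d b) (w i j)%:E * (dir_dens (a2 i j) s)%:E)%E.
have QE (w : cell d b -> cell d b -> R) : (forall i j, 0 <= w i j) ->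
    [/\ iterint mu N.-1 (Q w) =
       ((\sum_i \sum_j w i j * dir_moment2 a i j)%:E * dir_norm a)%E,
       imeas mu N.-1 (Q w) & forall s, (0 <= Q w s)%E].
  move=> w0.
  have D0 i j s : (0 <= (dir_dens (a2 i j) s)%:E)%E by rewrite lee_fin dir_dens_ge0.
  have T0 i j s : (0 <= (w i j)%:E * (dir_dens (a2 i j) s)%:E)%E.
    by rewrite mule_ge0// lee_fin.
  have T1 i := @iterint_sum _ _ _ mu _ (index_enum (cell d b)) N.-1 _ (T0 i)
     (fun j => @imeasZ _ _ _ mu N.-1 _ (w i j) (w0 i j) (D0 i j) (imeas_dir_dens (a2 i j))).
  have U0 i s : (0 <= \sum_(j : cell d b) (w i j)%:E * (dir_dens (a2 i j) s)%:E)%E.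
    by apply: sume_ge0 => j _.
  have [T2 T3] := @iterint_sum _ _ _ mu _ (index_enum (cell d b)) N.-1 _ U0
     (fun i => proj2 (T1 i)).
  split => //; last by move=> s; apply: sume_ge0 => i _.
  rewrite T2 -[in RHS](fineK Zf) -EFinM mulr_suml -sumEFin; apply: eq_bigr => i _.
  rewrite (proj1 (T1 i)) mulr_suml -sumEFin; apply: eq_bigr => j _.
  rewrite (@iterintZ _ _ _ mu N.-1 _ (w i j) (w0 i j) (D0 i j) (imeas_dir_dens (a2 i j))).
  by rewrite -/(dir_norm (a2 i j)) dir_norm_succ2// muleA -(fineK Zf) -!EFinM.
(* [m] may have negative entries, whereas linearity of [iterint] holds for nonnegative integrands;
   so the positive and negative parts are integrated separately. *)
pose mp i j := Num.max (m i j) 0; pose mn i j := Num.max (- m i j) 0.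
have mE i j : m i j = mp i j - mn i j.
  by rewrite /mp /mn; case: (leP (m i j) 0) => h; case: leP => h'; lra.
have [P1 _ P3] : [/\ _, _ & _] := QE mp (fun i j => ltac:(by rewrite le_max lexx orbT)).
have [N1 N2 N3] : [/\ _, _ & _] := QE mn (fun i j => ltac:(by rewrite le_max lexx orbT)).
(* Markov's inequality pointwise, with the negative part moved to the left to avoid a
   subtraction. *)
have FQ s : size s = N.-1 -> (F s + Q mn s <= Q mp s)%E.
  move=> sN; have QF w : Q w s =
      ((\sum_i \sum_j w i j * (spt s i * spt s j)) * dir_dens a s)%:E.
    rewrite mulr_suml -sumEFin; apply: eq_bigr => i _.
    rewrite mulr_suml -sumEFin; apply: eq_bigr => j _.
    rewrite -EFinM (dir_dens_succ (fun k => a k + (k == i)%:R))// dir_dens_succ//.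
    by congr (_%:E); ring.
  rewrite !QF -EFinD lee_fin -mulrDl.
  have [->|dn] := eqVneq (dir_dens a s) 0; first by rewrite !mulr0.
  rewrite ler_wpM2r ?dir_dens_ge0// -lerBrDr -sumrB.
  under eq_bigr do rewrite -sumrB.
  under eq_bigr do under eq_bigr do rewrite -mulrBl -mE.
  have h : all (fun x => 0 < x) s && (\sum_(x <- s) x < 1).
    by move: dn; rewrite /dir_dens; case: ifP => //; rewrite eqxx.
  have x0 j := simplex_pt_gt0 j sN h.
  have x1 := sum_simplex_pt sN.
  rewrite indicE; case: (boolP (spt s \in S)) => [/set_mem xS|_].
    exact: m1.
  exact: m0.
(* [S] is arbitrary, so [F] need not be measurable; superadditivity goes in the direction
   required. *)
have : (iterint mu N.-1 F + iterint mu N.-1 (Q mn) <= iterint mu N.-1 (Q mp))%E.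
  apply: le_trans (@iterint_superadditive _ _ _ mu N.-1 F (Q mn) F0 N3 N2) _.
  apply: le_iterint => // s.
  by rewrite adde_ge0.
have F1 : (0 <= iterint mu N.-1 F)%E by apply: iterint_ge0 => s; exact: F0.
rewrite P1 N1 -(fineK Zf) -!EFinM -/F ler_pdivrMr//.
case: (iterint mu N.-1 F) F1 => [r| |]//= _; rewrite -EFinD lee_fin.
rewrite -lerBrDr -mulrBl => /le_trans; apply; rewrite ler_pM2r//.
rewrite -sumrB le_eqVlt; apply/orP; left; apply/eqP; apply: eq_bigr => i _.
rewrite -sumrB; apply: eq_bigr => j _.
by rewrite -mulrBl -mE.
Qed.

(** Variance of the linear form [h]: its mean is zero, so the part [a i * a j] of the moments
    cancels and the diagonal part remains. *)
Lemma dir_moment2_square a (h : cell d b -> R) (A := \sum_k a k) :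
  0 < A -> \sum_i h i * a i = 0 ->
  \sum_i \sum_j h i * h j * dir_moment2 a i j =
  (\sum_i h i ^+ 2 * (a i / A)) / (1 + A).
Proof.
move=> A0 ha0.
have An : A != 0 by rewrite gt_eqF.
have An1 : 1 + A != 0 by rewrite gt_eqF// addr_gt0.
rewrite mulr_suml; apply: eq_bigr => i _.
transitivity (h i * a i / A / (1 + A) * \sum_j (h j * a j + h j * (j == i)%:R)).
  rewrite mulr_sumr; apply: eq_bigr => j _.
  by rewrite /dir_moment2 -/A; field; rewrite An An1.
rewrite big_split/= ha0 add0r (bigD1 i)//= eqxx big1 ?addr0 ?mulr1 => [|j /negbTE ->].
  by field; rewrite An1 An.
by rewrite mulr0.
Qed.

Lemma sum_dir_moment2 a : 0 < \sum_k a k ->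
  \sum_i \sum_j dir_moment2 a i j = 1.
Proof.
set A := \sum_k a k => A0.
have An : A != 0 by rewrite gt_eqF.
have An1 : 1 + A != 0 by rewrite gt_eqF// addr_gt0.
transitivity (\sum_i a i / A); last by rewrite -mulr_suml divff.
apply: eq_bigr => i _; rewrite /dir_moment2 -/A -mulr_sumr -mulr_suml big_split/=.
have -> : \sum_j (j == i)%:R = 1 :> R.
  by rewrite (bigD1 i)//= eqxx big1 ?addr0// => k /negbTE ->.
by rewrite -/A addrC divff// mulr1.
Qed.

End DirichletMoments.

(** * Transport along a finite tree *)

Section FiniteTransport.
Context {R : realFieldType} {I : finType}.
Implicit Types (mu nu rho : I -> R) (w c : I -> I -> R).

Definition transport mu nu w :=
  [/\ forall i j, 0 <= w i j, forall i, \sum_j w i j = mu i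
    & forall j, \sum_i w i j = nu j].

Definition cost c w := \sum_i \sum_j w i j * c i j.

Lemma transport_refl mu : (forall i, 0 <= mu i) ->
  transport mu mu (fun i j => if i == j then mu i else 0).
Proof.
move=> mu0; split => [i j|i|j]; first by case: ifP.
  by rewrite -big_mkcond/= (big_pred1 i)// => j; rewrite eq_sym.
by rewrite -big_mkcond/= (big_pred1 j).
Qed.

(** The composite plan makes the endpoints conditionally independent given the middle point; the
    triangle inequality is then averaged over triples. *)
Lemma transport_glue mu nu rho c w1 w2 :
  (forall i j k, c i k <= c i j + c j k) ->
  transport mu nu w1 -> transport nu rho w2 ->
  exists w, transport mu rho w /\ cost c w <= cost c w1 + cost c w2.
Proof.
move=> tri [w10 w11 w12] [w20 w21 w22].
have nu0 j : 0 <= nu j by rewrite -w12 sumr_ge0.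
(* Where [nu j] vanishes, so do the entries of [w1] and [w2] through [j]; this agrees with division
   by zero returning 0. *)
have z1 i j : nu j = 0 -> w1 i j = 0.
  move=> nuj; apply/eqP; rewrite eq_le w10 andbT -nuj -w12 (bigD1 i)//= lerDl.
  by rewrite sumr_ge0.
have z2 j k : nu j = 0 -> w2 j k = 0.
  move=> nuj; apply/eqP; rewrite eq_le w20 andbT -nuj -w21 (bigD1 k)//= lerDl.
  by rewrite sumr_ge0.
have r1 i j : \sum_k w1 i j * w2 j k / nu j = w1 i j.
  rewrite -mulr_suml -mulr_sumr w21.
  by have [/z1 ->|n] := eqVneq (nu j) 0; [rewrite !mul0r|rewrite mulfK].
have r2 j k : \sum_i w1 i j * w2 j k / nu j = w2 j k.
  rewrite -mulr_suml -mulr_suml w12.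
  by have [/z2 ->|n] := eqVneq (nu j) 0; [rewrite mulr0 mul0r|rewrite mulrAC divff ?mul1r].
have w0 i j k : 0 <= w1 i j * w2 j k / nu j by rewrite !mulr_ge0// invr_ge0.
exists (fun i k => \sum_j w1 i j * w2 j k / nu j); split.
  split=> [i k|i|k]; first exact: sumr_ge0.
    by rewrite exchange_big/=; under eq_bigr do rewrite r1.
  by rewrite exchange_big/=; under eq_bigr do rewrite r2.
have -> : cost c w1 = \sum_i \sum_k \sum_j w1 i j * w2 j k / nu j * c i j.
  apply: eq_bigr => i _; rewrite exchange_big/=; apply: eq_bigr => j _.
  by rewrite -mulr_suml r1.
have -> : cost c w2 = \sum_i \sum_k \sum_j w1 i j * w2 j k / nu j * c j k.
  rewrite /cost [LHS]exchange_big [RHS]exchange_big/=; apply: eq_bigr => k _.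
  rewrite [RHS]exchange_big/=; apply: eq_bigr => j _.
  by rewrite -mulr_suml r2.
rewrite -big_split; apply: ler_sum => i _; rewrite -big_split; apply: ler_sum => k _.
rewrite -big_split/= mulr_suml; apply: ler_sum => j _.
by rewrite -mulrDr ler_wpM2l.
Qed.

(* Within each fibre of [f] the common mass [min mu nu] stays in place and the
   excess is redistributed independently. *)
Lemma transport_fibre (J : eqType) (f : I -> J) mu nu c (C : R) :
  (forall i, 0 <= mu i) -> (forall i, 0 <= nu i) ->
  (forall i, \sum_(j | f j == f i) mu j = \sum_(j | f j == f i) nu j) ->
  (forall i, c i i = 0) -> 0 <= C -> (forall i j, f i = f j -> c i j <= C) ->
  exists w, transport mu nu w /\ cost c w <= C * \sum_i `|mu i - nu i|.
Proof.
move=> mu0 nu0 fib c0 C0 cC.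
pose mi i := Num.min (mu i) (nu i).
pose p i := mu i - mi i; pose q i := nu i - mi i.
pose D i := \sum_(j | f j == f i) p j.
have p0 i : 0 <= p i by rewrite subr_ge0 ge_min lexx.
have q0 i : 0 <= q i by rewrite subr_ge0 ge_min lexx orbT.
have Dq i : D i = \sum_(j | f j == f i) q j by rewrite /D /p /q !sumrB fib.
have D0 i : 0 <= D i by apply: sumr_ge0.
have Dz i : D i = 0 -> p i = 0 /\ q i = 0.
  move=> Di; split; apply/eqP; rewrite eq_le ?p0 ?q0 andbT -Di.
    by rewrite /D (bigD1 i)//= lerDl sumr_ge0.
  by rewrite Dq (bigD1 i)//= lerDl sumr_ge0.
have Df i j : f i = f j -> D i = D j by rewrite /D => ->.
pose e i j := if f j == f i then p i * q j / D i else 0.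
have e0 i j : 0 <= e i j by rewrite /e; case: ifP => // _; rewrite !mulr_ge0// invr_ge0.
have er i : \sum_j e i j = p i.
  rewrite -big_mkcond/= -mulr_suml -mulr_sumr -Dq.
  have [/Dz[-> _]|n] := eqVneq (D i) 0; first by rewrite !mul0r.
  by rewrite mulfK.
have ec j : \sum_i e i j = q j.
  transitivity (\sum_i (if f i == f j then p i * q j / D j else 0)).
    by apply: eq_bigr => i _; rewrite /e eq_sym; case: eqP => // /Df ->.
  rewrite -big_mkcond/= -mulr_suml -mulr_suml -/(D j).
  have [/Dz[_ ->]|n] := eqVneq (D j) 0; first by rewrite mulr0 mul0r.
  by rewrite mulrAC divff ?mul1r.
have mi0 i : 0 <= mi i by rewrite le_min mu0 nu0.
have [t0 t1 t2] := transport_refl mi0.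
exists (fun i j => (if i == j then mi i else 0) + e i j); split.
  split=> [i j|i|j]; first exact: addr_ge0.
    by rewrite big_split/= t1 er addrC subrK.
  by rewrite big_split/= t2 ec addrC subrK.
rewrite mulr_sumr; apply: ler_sum => i _.
apply: (@le_trans _ _ (\sum_j e i j * C)).
  apply: ler_sum => j _; rewrite mulrDl -[leRHS]add0r; apply: lerD.
    by case: eqP => [->|_]; rewrite ?c0 ?mulr0 ?mul0r.
  rewrite /e; case: eqP => [/esym/cC|_]; last by rewrite !mul0r.
  by apply: ler_wpM2l; rewrite !mulr_ge0// invr_ge0.
rewrite -mulr_suml er mulrC ler_wpM2l// /p /mi.
by have [h|h] := leP (mu i) (nu i); rewrite ?subrr// ger0_norm// subr_ge0 ltW.
Qed.

(** * Interpolation along nested partitions *)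

Section Refinement.
Variables (J : nat -> finType) (f : forall k, I -> J k) (K : nat) (ck : nat -> R).
Hypothesis f_refine : forall k i j, (k < K)%N -> f k.+1 i = f k.+1 j -> f k i = f k j.
Hypothesis f0 : forall i j, f 0 i = f 0 j.
Hypothesis fK : injective (f K).
Hypothesis ck0 : forall k, 0 <= ck k.
Variables mu nu : I -> R.
Hypothesis mu0 : forall i, 0 <= mu i.
Hypothesis nu0 : forall i, 0 < nu i.
Hypothesis mu1 : \sum_i mu i = 1.
Hypothesis nu1 : \sum_i nu i = 1.

(** Mass of the level-[k] class of [i]. Indexing by elements instead of classes keeps all levels on
    the type [I]. *)
Definition fmass (m : I -> R) k i := \sum_(j | f k j == f k i) m j.

Definition fweight k i := nu i / fmass nu k i.

(** A difference of class masses, written as a homogeneous linear form in [mu] so that its square is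
    a quadratic form. *)
Definition fdiff k i := \sum_j ((f k j == f k i)%:R - fmass nu k i) * mu j.

(** Each level contributes a pseudometric, so the triangle inequality holds for any nonnegative
    weights, in particular for [v]-th powers of diameters. *)
Definition tree_cost i j := \sum_(k < K) ck k * (f k.+1 i != f k.+1 j)%:R.

Let fmass_gt0 k i : 0 < fmass nu k i.
Proof.
by rewrite /fmass (bigD1 i)//= ltr_wpDr// sumr_ge0// => j _; exact: ltW.
Qed.

Lemma fweight_ge0 k i : 0 <= fweight k i.
Proof. by rewrite divr_ge0// ltW. Qed.

Lemma fdiffE k i : fdiff k i = fmass mu k i - fmass nu k i.
Proof.
rewrite /fdiff; under eq_bigr do rewrite mulrBl; rewrite sumrB -mulr_sumr mu1 mulr1.
congr (_ - _); rewrite /fmass [RHS]big_mkcond/=; apply: eq_bigr => j _.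
by case: ifP; rewrite ?mul1r ?mul0r.
Qed.

(** It has the class masses of [mu] and the conditional laws of [nu]. It is [nu] at level 0 and [mu]
    at level [K], and levels [k] and [k.+1] agree on level-[k] classes. *)
Let interp k i := fmass mu k i * fweight k i.

Let interp_ge0 k i : 0 <= interp k i.
Proof. by rewrite mulr_ge0 ?fweight_ge0// sumr_ge0. Qed.

Let sum_fweight k i : \sum_(j | f k j == f k i) fweight k j = 1.
Proof.
transitivity (\sum_(j | f k j == f k i) nu j / fmass nu k i).
  by apply: eq_bigr => j /eqP e; rewrite /fweight /fmass e.
by rewrite -mulr_suml -/(fmass nu k i) divff// gt_eqF.
Qed.

(** Each inhabited class contributes exactly 1. *)
Lemma sum_fweight_le k : \sum_i fweight k i <= #|J k|%:R.
Proof.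
rewrite (partition_big (f k) xpredT)//= -sum1_card natr_sum.
apply: ler_sum => y _.
have [/existsP[i /eqP <-]|/existsPn h] := boolP [exists i, f k i == y].
  by rewrite sum_fweight.
by rewrite big_pred0 => // i; exact/negbTE.
Qed.

Let f_coarse k l x y : (k <= l <= K)%N -> f l x = f l y -> f k x = f k y.
Proof.
move=> /andP[kl lK]; move: l kl lK; elim=> [|l IH]; first by rewrite leqn0 => /eqP ->.
rewrite leq_eqVlt => /predU1P[->//|kl] lK /(f_refine lK); apply: IH => //.
exact: ltnW.
Qed.

(** A level-[k] class is a disjoint union of level-[l] classes. *)
Lemma fmass_coarse (m : I -> R) k l i : (k <= l <= K)%N ->
  forall g : I -> R, (forall x, fmass g l x = fmass m l x) ->
  fmass g k i = fmass m k i.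
Proof.
move=> /andP[kl lK] g gm.
have ref x y : f l x = f l y -> f k x = f k y by apply: f_coarse; rewrite kl.
have part (h : I -> R) : fmass h k i =
    \sum_(y : J l) \sum_(j | (f k j == f k i) && (f l j == y)) h j.
  by rewrite /fmass (partition_big (f l) xpredT).
rewrite !part; apply: eq_bigr => y _.
have [/existsP[j /andP[/eqP ji /eqP jy]]|/existsPn no] :=
    boolP [exists j, (f k j == f k i) && (f l j == y)]; last first.
  by rewrite !big_pred0 => // j; exact/negbTE.
have e h : \sum_(j | (f k j == f k i) && (f l j == y)) h j = fmass h l j.
  apply: eq_bigl => x; rewrite jy; apply/andP/idP => [[]//|/eqP xy]; split.
    by rewrite -ji; apply/eqP/ref; rewrite xy.
  exact/eqP.
by rewrite !e.
Qed.

Let fmass_interp k i : fmass (interp k) k i = fmass mu k i.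
Proof.
transitivity (\sum_(j | f k j == f k i) fmass mu k i * fweight k j).
  by apply: eq_bigr => j /eqP e; rewrite /interp /fmass e.
by rewrite -mulr_sumr sum_fweight mulr1.
Qed.

(** The weights add up to 1 in a class, so this sums the absolute mass differences over the classes;
    it is also the l1 distance from [interp k] to [nu]. *)
Definition fvar k := \sum_i fweight k i * `|fdiff k i|.

Let interp_dist k : \sum_i `|interp k i - nu i| = fvar k.
Proof.
apply: eq_bigr => i _; rewrite fdiffE -[X in X * _]ger0_norm ?fweight_ge0// -normrM.
congr `|_|; rewrite mulrBr /interp mulrC /fweight divfK// gt_eqF//.
Qed.

Lemma tree_cost_refl i : tree_cost i i = 0.
Proof. by rewrite /tree_cost big1// => k _; rewrite eqxx mulr0. Qed.

Lemma tree_cost_triangle i j l : tree_cost i l <= tree_cost i j + tree_cost j l.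
Proof.
rewrite -big_split; apply: ler_sum => k _ /=; rewrite -mulrDr ler_wpM2l// -natrD ler_nat.
case: (eqVneq (f k.+1 i) (f k.+1 j)) => [->|_]; first by rewrite ?eqxx ?add0n.
exact: leq_trans (leq_b1 _) (leq_addr _ _).
Qed.

Lemma tree_cost_le k i j : (k <= K)%N -> f k i = f k j ->
  tree_cost i j <= \sum_(k <= m < K) ck m.
Proof.
move=> kK fk.
have -> : tree_cost i j = \sum_(0 <= m < K) ck m * (f m.+1 i != f m.+1 j)%:R.
  by rewrite big_mkord.
rewrite (big_cat_nat _ kK)//= big1_seq ?add0r => [|m /andP[_]]; last first.
  rewrite mem_index_iota => /andP[_ mk].
  by rewrite (@f_coarse m.+1 k i j) ?mk ?kK// eqxx mulr0.
apply: ler_sum => m _; rewrite -[leRHS]mulr1 ler_wpM2l// lern1.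
by case: (_ == _).
Qed.

(** The steps from [interp n] to [interp n.+1] move mass only inside level-[n] classes and are glued
    together; the l1 size of a step is estimated by passing through [nu]. *)
Lemma tree_transport : exists w, transport nu mu w /\
  cost tree_cost w <= \sum_(k < K) (\sum_(k <= m < K) ck m) * (fvar k + fvar k.+1).
Proof.
have i0 : interp 0 = nu.
  apply/funext => i; rewrite /interp /fweight /fmass.
  under eq_bigl do rewrite (f0 _ i) eqxx; under [X in _ / X]eq_bigl do rewrite (f0 _ i) eqxx.
  by rewrite mu1 nu1 mul1r divr1.
have iK : interp K = mu.
  apply/funext => i; rewrite /interp /fweight /fmass.
  have e j : (f K j == f K i) = (j == i) by apply/eqP/eqP => [/fK|->].
  under eq_bigl do rewrite e; under [X in _ / X]eq_bigl do rewrite e.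
  by rewrite !big_pred1_eq divff ?mulr1// gt_eqF.
rewrite -{1}i0 -{1}iK.
suff H n : (n <= K)%N -> exists w, transport (interp 0) (interp n) w /\
  cost tree_cost w <= \sum_(k < n) (\sum_(k <= m < K) ck m) * (fvar k + fvar k.+1).
  exact: H.
elim: n => [_|n IH nK].
  exists (fun i j => if i == j then interp 0 i else 0); split.
    exact: transport_refl.
  rewrite big_ord0 /cost big1// => i _; rewrite big1// => j _.
  by case: eqP => [->|_]; rewrite ?tree_cost_refl ?mulr0 ?mul0r.
have [w1 [T1 C1]] := IH (ltnW nK).
have Cn0 : 0 <= \sum_(n <= m < K) ck m by apply: sumr_ge0.
have [w2 [T2 C2]] := @transport_fibre (J n) (f n) (interp n) (interp n.+1) tree_cost _
  (interp_ge0 n) (interp_ge0 n.+1)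
  (fun i => etrans (fmass_interp n i) (esym (@fmass_coarse mu n n.+1 i
     (introT andP (conj (leqnSn n) nK)) _ (fmass_interp n.+1))))
  tree_cost_refl Cn0 (fun i j => tree_cost_le (ltnW nK)).
have [w [T C]] := transport_glue tree_cost_triangle T1 T2.
exists w; split => //; apply: le_trans C _.
rewrite big_ord_recr/=; apply: lerD => //; apply: le_trans C2 _.
rewrite ler_wpM2l// -!interp_dist -big_split/=; apply: ler_sum => i _.
by rewrite [X in _ <= _ + X]distrC; apply: ler_distD.
Qed.

End Refinement.
End FiniteTransport.

(** * Couplings of piecewise uniform measures *)

Section UniformBox.
Context {R : realType}.
Local Notation mu := (@lebesgue_measure R).

Definition rdcons n (z : measurableTypeR R * Rd R n) : Rd R n.+1 :=
  fun i => if unlift ord0 i is Some k then z.2 k else z.1.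

Lemma rdcons_vecpt n y (s : seq R) : rdcons (y, vecpt s : Rd R n) = vecpt (y :: s).
Proof.
apply/funext => i; rewrite /rdcons; case: unliftP => [k ->|->]//=.
Qed.

Lemma measurable_rdcons n : measurable_fun setT (@rdcons n).
Proof.
apply: (@measurability _ _ (measurableTypeR R * Rd R n)%type (Rd R n.+1) setT
  (@rdcons n) (@box_sets R n.+1) erefl).
move=> _ [_ [B [mB ->]] <-]; rewrite setTI.
rewrite (_ : _ @^-1` _ = B ord0 `*` [set x | forall k, B (lift ord0 k) (x k)]).
  apply: measurableX; first exact: mB.
  by apply: sub_sigma_algebra; exists (fun k => B (lift ord0 k)); split.
apply/seteqP; split => [[y x] /= h|[y x] /= [h0 h] i].
  split=> [|k]; first by have := h ord0; rewrite /rdcons unlift_none.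
  by have := h (lift ord0 k); rewrite /rdcons liftK.
by rewrite /rdcons; case: unliftP => [k ->|->].
Qed.

Definition box_dens n (lo hi : 'I_n -> R) (s : seq R) : R :=
  \prod_(l < n) (if lo l <= s`_l < hi l then (hi l - lo l)^-1 else 0).

Lemma box_dens_ge0 n (lo hi : 'I_n -> R) s : (forall l, lo l < hi l) ->
  0 <= box_dens lo hi s.
Proof.
move=> lh; apply: prodr_ge0 => l _; case: ifP => // _.
by rewrite invr_ge0 subr_ge0 ltW.
Qed.

(** One-dimensional uniform laws are multiplied one coordinate at a time, and Tonelli identifies the
    integral with the iterated one. [imeas] is carried along for later sums. *)
Lemma uniform_box n (lo hi : 'I_n -> R) : (forall l, lo l < hi l) ->
  exists M : probability (Rd R n) R, forall f : Rd R n -> \bar R,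
    measurable_fun setT f -> (forall x, 0 <= f x)%E ->
    iterint mu n (fun s => (box_dens lo hi s)%:E * f (vecpt s))%E = (\int[M]_x f x)%E
    /\ imeas mu n (fun s => (box_dens lo hi s)%:E * f (vecpt s))%E.
Proof.
elim: n lo hi => [|n IH] lo hi lh.
  exists (dirac (vecpt [::] : Rd R 0)) => f mf f0; split => //=.
  by rewrite /box_dens big_ord0 mul1e integral_dirac// diracT mul1e.
have [M HM] := IH (fun l => lo (lift ord0 l)) (fun l => hi (lift ord0 l))
  (fun l => lh (lift ord0 l)).
pose a := lo ord0; pose b := hi ord0.
have ab : a < b := lh ord0.
have ba0 : 0 <= (b - a)^-1 by rewrite invr_ge0 subr_ge0 ltW.
pose P : probability (measurableTypeR R * Rd R n)%type R := (uniform_prob ab \x M)%E.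
pose X : {RV P >-> Rd R n.+1} := HB.pack (@rdcons n)
  (isMeasurableFun.Build _ _ _ _ _ (@measurable_rdcons n)).
exists (distribution P X) => f mf f0.
pose g := (fun z => f (rdcons z)) : measurableTypeR R * Rd R n -> \bar R.
have mg : measurable_fun setT g by apply: measurableT_comp => //; exact: measurable_rdcons.
have g0 z : (0 <= g z)%E by exact: f0.
have mgy y : measurable_fun setT (fun x => g (y, x)).
  by apply: measurableT_comp => //; exact: measurable_pair1.
pose c (y : R) : R := if a <= y < b then (b - a)^-1 else 0.
have c0 y : 0 <= c y by rewrite /c; case: ifP.
pose h y := (\int[M]_x g (y, x))%E.
have h0 y : (0 <= h y)%E by exact: integral_ge0.
have mh : measurable_fun setT h by exact: measurable_fun_fubini_tonelli_F.
have FE y s : ((box_dens lo hi (y :: s))%:E * f (vecpt (y :: s)) =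
    (c y)%:E * ((box_dens (fun l => lo (lift ord0 l)) (fun l => hi (lift ord0 l)) s)%:E *
      g (y, vecpt s : Rd R n)))%E.
  by rewrite /box_dens big_ord_recl/= EFinM -muleA /g rdcons_vecpt.
have inner y : iterint mu n (fun s => (box_dens lo hi (y :: s))%:E * f (vecpt (y :: s)))%E =
      ((c y)%:E * h y)%E /\
    imeas mu n (fun s => (box_dens lo hi (y :: s))%:E * f (vecpt (y :: s)))%E.
  have [I1 I2] := HM _ (mgy y) (fun x => g0 (y, x)).
  have k0 (s : seq (measurableTypeR R)) : (0 <= (box_dens (fun l => lo (lift ord0 l))
      (fun l => hi (lift ord0 l)) s)%:E * g (y, vecpt s : Rd R n))%E.
    by rewrite mule_ge0// lee_fin box_dens_ge0.
  split.
    under eq_iterint do rewrite FE.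
    by rewrite (@iterintZ _ _ _ mu n _ (c y) (c0 y) k0 I2) I1.
  by apply: eq_imeas (@imeasZ _ _ _ mu n _ (c y) (c0 y) k0 I2) => s _; rewrite FE.
have mc : measurable_fun setT c.
  apply: measurable_fun_ifT => //; apply: measurable_and.
    exact: measurable_fun_ler.
  exact: measurable_fun_ltr.
have E : (fun y => iterint mu n (fun s => (box_dens lo hi (y :: s))%:E *
    f (vecpt (y :: s))))%E = (fun y => (c y)%:E * h y)%E.
  by apply/funext => y; case: (inner y).
split; last first.
  split; first by move=> y; case: (inner y).
  rewrite E; apply: emeasurable_funM => //; exact/measurable_EFinP.
rewrite ge0_integral_distribution//.
transitivity (\int[P]_z g z)%E; last by [].
rewrite fubini_tonelli1// -/h integral_uniform//.
rewrite [LHS]/iterint -/(@iterint _ _ _ _) E.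
rewrite -[RHS]ge0_integralZl_EFin//; [|by move=> y _; exact: h0|exact: measurable_funTS].
(* The uniform law integrates over [[a, b]], while the density is supported on [[a, b[]; the
   endpoint is null. *)
rewrite -[RHS]integral_itv_bndo_bndc; last first.
  by apply: measurable_funTS; exact: measurable_funeM.
rewrite [RHS]integral_mkcond; apply: eq_integral => y _.
rewrite patchE /c mem_setE in_itv/=.
by case: ifP => // _; rewrite mul0e.
Qed.

End UniformBox.

Section Mixture.
Import HBNNSimple.

(** For the bound with arbitrary [f], simple functions below [f] integrate linearly against the
    mixture, and each component integral is at most that of [f]. *)
Lemma finite_mixture {dX : measure_display} {X : measurableType dX} {R : realType}
  (T : finType) (w : T -> R) (P : T -> probability X R) :
  (forall t, 0 <= w t) -> \sum_t w t = 1 ->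
  exists Q : probability X R,
    (forall A, measurable A -> Q A = \sum_(t : T) (w t)%:E * P t A)%E /\
    (forall f, (forall x, 0 <= f x)%E ->
      (\int[Q]_x f x <= \sum_(t : T) (w t)%:E * \int[P t]_x f x)%E).
Proof.
move=> w0 w1.
have [t0 _] : exists t0 : T, True.
  have [t0 _|none] := pickP (pred_of_argType T); first by exists t0.
  by move: w1; rewrite big_pred0// => /eqP; rewrite eq_sym oner_eq0.
pose t_ k := nth t0 (enum T) k.
have sumE (F : T -> \bar R) : (\sum_(k < #|T|) F (t_ k) = \sum_t F t)%E.
  rewrite -[RHS]big_enum [in RHS](big_nth t0) -cardE big_mkord.
  by [].
pose m k : {measure set X -> \bar R} := mscale (NngNum (w0 (t_ k))) (P (t_ k)).
pose nu : {measure set X -> \bar R} := msum m #|T|.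
have nuE A : nu A = (\sum_(t : T) (w t)%:E * P t A)%E.
  by rewrite -(sumE (fun t => (w t)%:E * P t A)%E).
have nu1 : nu setT = 1%E.
  rewrite nuE; under eq_bigr do rewrite probability_setT mule1.
  by rewrite sumEFin w1.
pose Q : probability X R := HB.pack (msum m #|T|)
  (@Measure_isProbability.Build _ _ _ (msum m #|T|) nu1).
exists Q; split; first by move=> A _; exact: nuE.
move=> f f0; rewrite ge0_integralTE//; apply: ge_ereal_sup => _ [h /= hf <-].
have h0 x : (0 <= (h x)%:E)%E by rewrite lee_fin.
have mh : measurable_fun setT (fun x => (h x)%:E) by exact/measurable_EFinP.
have -> : sintegral Q h = (\int[nu]_x (h x)%:E)%E.
  by rewrite integral_nnsfun// patch_setT.
rewrite ge0_integral_measure_sum//.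
have mE k : (\int[m k]_x (h x)%:E = (w (t_ k))%:E * \int[P (t_ k)]_x (h x)%:E)%E.
  by rewrite /m ge0_integral_mscale.
rewrite (eq_bigr (fun k : 'I_#|T| => (w (t_ k))%:E * \int[P (t_ k)]_x (h x)%:E)%E);
  last by move=> k _; exact: mE.
rewrite (sumE (fun t => (w t)%:E * \int[P t]_x (h x)%:E)%E).
apply: lee_sum => t _; apply: lee_wpmul2l; first by rewrite lee_fin.
exact: le_integral_nonmeas.
Qed.

End Mixture.

(** * From discrete transport plans to Wasserstein bounds *)

Section Cells.
Context {R : realType} {d b : nat}.
Hypothesis b0 : (0 < b)%N.
Local Notation mu := (@lebesgue_measure R).

Let lo (i : cell d b) l : R := (i l)%:R / b%:R.
Let hi (i : cell d b) l : R := (i l).+1%:R / b%:R.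

Let bR : (0 : R) < b%:R. Proof. by rewrite ltr0n. Qed.

Let lohi i l : lo i l < hi i l.
Proof. by rewrite ltr_pM2r ?invr_gt0// ltr_nat. Qed.

Let hiBlo i l : (hi i l - lo i l)^-1 = b%:R.
Proof. by rewrite -mulrBl -natrB// subSnn mul1r invrK. Qed.

Lemma measurable_cellset (i : cell d b) :
  measurable (@cellset R d b i : set (Rd R d)).
Proof.
apply: sub_sigma_algebra; exists (fun l => `[lo i l, hi i l[%classic); split.
  by move=> l; exact: measurable_itv.
by apply/seteqP; split => x h l; have := h l; rewrite /= in_itv.
Qed.

Lemma box_dens_cell (i : cell d b) s :
  box_dens (lo i) (hi i) s = b%:R ^+ d * \1_(@cellset R d b i) (vecpt s).
Proof.
rewrite indicE; case: (boolP (_ \in _)) => [/set_mem h|/negP h].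
  rewrite /box_dens; under eq_bigr => l _.
    by rewrite ifT ?hiBlo//; [over|exact: h].
  by rewrite prodr_const card_ord mulr1.
rewrite mulr0; have [l hl] : exists l, ~ (lo i l <= vecpt (d:=d) s l < hi i l).
  by apply: contrapT => nh; apply: h; apply/mem_set => l;
    apply: contrapT => hl; apply: nh; exists l.
by rewrite /box_dens (bigD1 l)//= ifF ?mul0r//; apply/negP.
Qed.

(* [U i] is the uniform distribution on the [i]-th cell. *)
Lemma cell_uniform : exists U : cell d b -> probability (Rd R d) R,
  (forall i, U i (@cellset R d b i) = 1%E) /\
  forall pv : cell d b -> R, (forall i, 0 <= pv i) ->
  forall A : set (Rd R d), measurable A ->
    psi pv A = (\sum_(i : cell d b) (pv i)%:E * U i A)%E.
Proof.
have [U HU] : {U : cell d b -> probability (Rd R d) R &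
  forall i (f : Rd R d -> \bar R), measurable_fun setT f -> (forall x, 0 <= f x)%E ->
    iterint mu d (fun s => (box_dens (lo i) (hi i) s)%:E * f (vecpt s))%E =
      (\int[U i]_x f x)%E
    /\ imeas mu d (fun s => (box_dens (lo i) (hi i) s)%:E * f (vecpt s))%E}.
  apply: (@choice _ _ (fun i (M : probability (Rd R d) R) =>
    forall f : Rd R d -> \bar R, measurable_fun setT f -> (forall x, 0 <= f x)%E ->
    iterint mu d (fun s => (box_dens (lo i) (hi i) s)%:E * f (vecpt s))%E =
      (\int[M]_x f x)%E
    /\ imeas mu d (fun s => (box_dens (lo i) (hi i) s)%:E * f (vecpt s))%E)) => i.
  exact: uniform_box (lohi i).
have mind (A : set (Rd R d)) : measurable A ->
    measurable_fun setT (fun x : Rd R d => (\1_A x : R)%:E).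
  by move=> mA; apply/measurable_EFinP; exact: measurable_indic.
have ind0 (A : set (Rd R d)) x : (0 <= (\1_A x : R)%:E)%E by rewrite lee_fin.
have UA i (A : set (Rd R d)) : measurable A -> iterint mu d
    (fun s => (box_dens (lo i) (hi i) s)%:E * (\1_A (vecpt s : Rd R d))%:E)%E = U i A.
  move=> mA; rewrite (HU i _ (mind A mA) (ind0 A)).1.
  by rewrite integral_indic// setIT.
exists U; split=> [i|pv pv0 A mA].
  rewrite -(UA i _ (measurable_cellset i)) -(probability_setT (U i)) -(UA i _ measurableT).
  apply: eq_iterint => s _; rewrite -!EFinM box_dens_cell indicT mulr1 -mulrA.
  by rewrite !indicE; case: (_ \in _); rewrite ?mulr1 ?mulr0.
rewrite /psi /lebint.
pose G i s : \bar R := ((box_dens (lo i) (hi i) s)%:E * (\1_A (vecpt s : Rd R d))%:E)%E.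
have G0 i s : (0 <= G i s)%E.
  by rewrite /G mule_ge0// lee_fin ?box_dens_ge0.
have iG i : imeas mu d (G i) := (HU i _ (mind A mA) (ind0 A)).2.
have [S1 _] := @iterint_sum _ _ _ mu _ (index_enum (cell d b)) d
  (fun i s => (pv i)%:E * G i s)%E
  (fun i s => mule_ge0 (pv0 i : (0 <= (pv i)%:E)%E) (G0 i s))
  (fun i => @imeasZ _ _ _ mu d _ (pv i) (pv0 i) (G0 i) (iG i)).
transitivity (iterint mu d (fun s => \sum_(i : cell d b) (pv i)%:E * G i s)%E).
  apply: eq_iterint => s _; rewrite mulr_sumr -sumEFin; apply: eq_bigr => i _.
  by rewrite /G box_dens_cell -!EFinM; congr (_%:E); ring.
rewrite S1; apply: eq_bigr => i _.
by rewrite (@iterintZ _ _ _ mu d _ (pv i) (pv0 i) (G0 i) (iG i)) UA.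
Qed.

(** The plan [w] is realized by the mixture of the product laws of [U i] and [U j] with weights
    [w i j]; each product lives on a pair of cells, where the cost is at most [C i j]. *)
Lemma Wass_le_cost (p v : R) (pv nu : cell d b -> R) w (C : cell d b -> cell d b -> R) :
  0 < v -> transport pv nu w -> \sum_i pv i = 1 ->
  (forall i j x y, @cellset R d b i x -> @cellset R d b j y ->
     lpdist p x y `^ v <= C i j) ->
  (Wass p v (psi pv) (psi nu) <= ((cost C w) `^ v^-1)%:E)%E.
Proof.
move=> v0 [w0 wr wc] pv1 HC.
have pv0 i : 0 <= pv i by rewrite -wr sumr_ge0.
have nu0 j : 0 <= nu j by rewrite -wc sumr_ge0.
have [U [Ucell Upsi]] := cell_uniform.
pose PP (t : cell d b * cell d b) : probability (Rd R d * Rd R d)%type R :=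
  (U t.1 \x U t.2)%E.
have W0 (t : cell d b * cell d b) : 0 <= w t.1 t.2 by [].
have W1 : \sum_(t : cell d b * cell d b) w t.1 t.2 = 1.
  rewrite -(pair_bigA _ (fun i j => w i j))/= -pv1.
  by apply: eq_bigr => i _.
have [Q [QA Qf]] := finite_mixture PP W0 W1.
have PPX t (A B : set (Rd R d)) : measurable A -> measurable B ->
    PP t (A `*` B) = (U t.1 A * U t.2 B)%E.
  by move=> mA mB; exact: product_measure1E.
have PPl i j (A : set (Rd R d)) : measurable A ->
    ((w i j)%:E * PP (i, j) (A `*` setT) = (w i j)%:E * U i A)%E.
  by move=> mA; rewrite PPX// probability_setT mule1.
have PPr i j (A : set (Rd R d)) : measurable A ->
    ((w i j)%:E * PP (i, j) (setT `*` A) = (w i j)%:E * U j A)%E.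
  by move=> mA; rewrite PPX// probability_setT mul1e.
have cpl : coupling (psi pv) (psi nu) Q.
  move=> A mA; split.
    rewrite QA; last exact: measurableX.
    rewrite Upsi// -(pair_bigA _ (fun i j => (w i j)%:E * PP (i, j) (A `*` setT))%E)/=.
    apply: eq_bigr => i _; rewrite -wr -sumEFin ge0_sume_distrl; last first.
      by move=> j _; rewrite lee_fin.
    by apply: eq_bigr => j _; exact: PPl.
  rewrite QA; last exact: measurableX.
  rewrite Upsi// -(pair_bigA _ (fun i j => (w i j)%:E * PP (i, j) (setT `*` A))%E)/=.
  rewrite exchange_big/=.
  apply: eq_bigr => i _; rewrite -wc -sumEFin ge0_sume_distrl; last first.
    by move=> j _; rewrite lee_fin.
  by apply: eq_bigr => j _; exact: PPr.
have costQ : (\int[Q]_z ((lpdist p z.1 z.2) `^ v)%:E <= (cost C w)%:E)%E.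
  apply: le_trans (Qf _ _) _; first by move=> x; rewrite lee_fin powR_ge0.
  rewrite /cost pair_bigA/= -sumEFin; apply: lee_sum => t _.
  rewrite EFinM; apply: lee_wpmul2l; first by rewrite lee_fin.
  apply: (@integral_le_of_prob1 _ _ _ (PP t)
    (@cellset R d b t.1 `*` @cellset R d b t.2)).
  - by apply: measurableX; exact: measurable_cellset.
  - by rewrite PPX ?Ucell ?mule1//; exact: measurable_cellset.
  - by move=> y; rewrite lee_fin powR_ge0.
  - by move=> y [h1 h2]; rewrite lee_fin; exact: HC.
rewrite /Wass -poweR_EFin; apply: gt0_ler_poweR.
- by rewrite invr_ge0 ltW.
- rewrite in_itv/= leey andbT; apply: le_ereal_inf_tmp => _ [pi [_ ->]].
  by apply: integral_ge0 => z _; rewrite lee_fin powR_ge0.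
- rewrite in_itv/= leey andbT; apply: le_trans costQ.
  by apply: integral_ge0 => z _; rewrite lee_fin powR_ge0.
- by apply: le_trans costQ; apply: ereal_inf_lbound; exists Q.
Qed.

End Cells.

(** * Dyadic cells *)

Section Dyadic.
Context {R : realType} {d K : nat}.
Local Notation cellK := (cell d (2 ^ K)).

Lemma pow2_gt0 k : (0 < 2 ^ k)%N.
Proof. by rewrite expn_gt0. Qed.

(* For [k <= K] the remainder is a no-op: it only makes the definition total. *)
Definition ancestor k (j : cellK) : cell d (2 ^ k) :=
  [ffun l => Ordinal (ltn_pmod (j l %/ 2 ^ (K - k)) (pow2_gt0 k))].

Lemma ancestorE k (j : cellK) l : (k <= K)%N ->
  ancestor k j l = (j l %/ 2 ^ (K - k))%N :> nat.
Proof.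
move=> kK; rewrite ffunE/= modn_small// ltn_divLR ?pow2_gt0//.
by rewrite -expnD subnKC.
Qed.

Lemma ancestor_refine k (i j : cellK) : (k < K)%N ->
  ancestor k.+1 i = ancestor k.+1 j -> ancestor k i = ancestor k j.
Proof.
move=> kK /ffunP e; apply/ffunP => l; apply: val_inj.
have := congr1 val (e l); rewrite /= !ancestorE ?(ltnW kK)// => el.
by rewrite -(subnSK kK) expnSr !divnMA el.
Qed.

Lemma ancestor0 (i j : cellK) : ancestor 0 i = ancestor 0 j.
Proof.
apply/ffunP => l; apply: val_inj => /=.
by case: (ancestor 0 i l) => -[]//= _; case: (ancestor 0 j l) => -[].
Qed.

Lemma ancestor_inj : injective (ancestor K).
Proof.
move=> i j /ffunP e; apply/ffunP => l; apply: val_inj.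
by have := congr1 val (e l); rewrite /= !ancestorE// subnn expn0 !divn1.
Qed.

Lemma ancestor_bounds k (i : cellK) (x : 'I_d -> R) l : (k <= K)%N ->
  cellset i x ->
  (ancestor k i l)%:R / 2 ^+ k <= x l < (ancestor k i l).+1%:R / 2 ^+ k.
Proof.
move=> kK /(_ l) /andP[h1 h2]; rewrite ancestorE//.
set e := (2 ^ (K - k))%N; have e0 : (0 < e)%N by exact: pow2_gt0.
have eR : (0 : R) < e%:R by rewrite ltr0n.
have KE : (2 ^ K)%:R = e%:R * 2 ^+ k :> R.
  by rewrite /e natrX natrX -exprD subnK.
have k0 : (0 : R) < 2 ^+ k by exact: exprn_gt0.
have cE (z : R) : z / 2 ^+ k = (z * e%:R) / (e%:R * 2 ^+ k).
  by field; rewrite !gt_eqF.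
have ek : 0 < (e%:R * 2 ^+ k : R)^-1 by rewrite invr_gt0 mulr_gt0.
rewrite !cE -KE; apply/andP; split.
  apply: le_trans h1; rewrite KE ler_pM2r// -natrM ler_nat.
  exact: leq_trunc_div.
apply: (lt_le_trans h2); rewrite KE ler_pM2r// -natrM ler_nat.
exact: ltn_ceil.
Qed.

(** Points of a common level-[k] cell differ by at most [2^-k] in each of the [d] coordinates. *)
Lemma lpdist_ancestor (p v : R) k (i j : cellK) (x y : 'I_d -> R) :
  0 < p -> 0 <= v -> (k <= K)%N -> cellset i x -> cellset j y ->
  ancestor k i = ancestor k j ->
  lpdist p x y `^ v <= (d%:R `^ p^-1) `^ v * (2^-1 `^ v) ^+ k.
Proof.
move=> p0 v0 kK ix jy ij.
have k0 : (0 : R) < 2 ^+ k by exact: exprn_gt0.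
have co l : `|x l - y l| <= 2^-1 ^+ k.
  have /andP[x1 x2] := ancestor_bounds l kK ix.
  have /andP[y1 y2] := ancestor_bounds l kK jy.
  move: x1 x2; rewrite ij -(natr1 (ancestor k j l)) mulrDl mul1r => x1 x2.
  move: y2; rewrite -(natr1 (ancestor k j l)) mulrDl mul1r => y2.
  rewrite exprVn ler_norml; apply/andP; split; lra.
have h0 : (0 : R) <= 2^-1 ^+ k by rewrite exprn_ge0.
have -> : (2^-1 `^ v) ^+ k = (2^-1 ^+ k) `^ v :> R.
  rewrite -[LHS]powR_mulrn ?powR_ge0// powRAC.
  by rewrite powR_mulrn// invr_ge0.
rewrite -powRM ?powR_ge0//; apply: ge0_ler_powR; rewrite ?nnegrE ?powR_ge0 ?mulr_ge0 ?powR_ge0//.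
rewrite /lpdist; have -> : d%:R `^ p^-1 * 2^-1 ^+ k = (d%:R * (2^-1 ^+ k) `^ p) `^ p^-1 :> R.
  by rewrite powRM ?powR_ge0// -powRrM divff ?gt_eqF// powRr1.
apply: ge0_ler_powR.
- by rewrite invr_ge0 ltW.
- by rewrite nnegrE sumr_ge0// => l _; exact: powR_ge0.
- by rewrite nnegrE mulr_ge0 ?powR_ge0.
apply: le_trans (_ : \sum_(l < d) (2^-1 ^+ k) `^ p <= _); last first.
  by rewrite sumr_const card_ord mulr_natl.
by apply: ler_sum => l _; apply: ge0_ler_powR; rewrite ?nnegrE// ltW.
Qed.

(** If [k < K] is the last common level of [i] and [j], the tree cost contains [ck k], which
    dominates the distance; if they never separate, the additional [ck K] does. *)
Lemma lpdist_tree_cost (p v : R) (ck := fun k => (d%:R `^ p^-1) `^ v * (2^-1 `^ v) ^+ k)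
  (i j : cellK) (x y : 'I_d -> R) :
  0 < p -> 0 <= v -> cellset i x -> cellset j y ->
  lpdist p x y `^ v <= tree_cost ancestor K ck i j + ck K.
Proof.
move=> p0 v0 ix jy.
have ck0 k : 0 <= ck k by rewrite mulr_ge0 ?exprn_ge0 ?powR_ge0.
(* Here [m] is the height above the finest level: a common ancestor at level [K - m] either persists
   one level down or marks the separation. *)
suff H m : (m <= K)%N -> ancestor (K - m) i = ancestor (K - m) j ->
    lpdist p x y `^ v <=
    \sum_(K - m <= k < K) ck k * (ancestor k.+1 i != ancestor k.+1 j)%:R + ck K.
  have := H K (leqnn K); rewrite subnn big_mkord; apply; exact: ancestor0.
elim: m => [_|m IH mK]; rewrite ?subn0 => e.
  by rewrite big_geq// add0r; exact: lpdist_ancestor e.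
have S : (K - m = (K - m.+1).+1)%N by rewrite subnSK.
rewrite big_ltn; last by rewrite ltn_subrL (leq_ltn_trans _ mK).
have [e'|ne] := eqVneq (ancestor (K - m.+1).+1 i) (ancestor (K - m.+1).+1 j).
  by rewrite mulr0 add0r -S; apply: IH; [exact: ltnW|rewrite S].
rewrite mulr1 -addrA; apply: le_trans (lpdist_ancestor p0 v0 (leq_subr _ _) ix jy e) _.
by rewrite lerDl addr_ge0// sumr_ge0// => k _; rewrite mulr_ge0.
Qed.

End Dyadic.

Lemma cube_cellset (R : realType) (d b : nat) (y : 'I_d -> R) : (0 < b)%N ->
  cube y -> exists j : cell d b, cellset j y.
Proof.
move=> b0 cy; have bR : (0 : R) < b%:R by rewrite ltr0n.
have y0 l : 0 <= y l * b%:R by case/andP: (cy l) => y0 _; rewrite mulr_ge0.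
have yb l : (Num.truncn (y l * b%:R) < b)%N.
  rewrite -(ltr_nat R); apply: le_lt_trans (_ : y l * b%:R < _).
    by case/andP: (truncn_itv (y0 l)).
  by rewrite -[ltRHS]mul1r ltr_pM2r//; case/andP: (cy l).
exists [ffun l => Ordinal (yb l)] => l; rewrite ffunE/=.
by rewrite ler_pdivrMr// ltr_pdivlMr//; exact: truncn_itv.
Qed.

(** Every point of the cube lies in some cell; hence the total posterior concentration is at least
    the sample size. *)
Lemma sum_cnt_ge (R : realType) (d b : nat) (ys : seq ('I_d -> R)) : (0 < b)%N ->
  (forall y, List.In y ys -> cube y) ->
  (size ys)%:R <= \sum_(j : cell d b) (cnt j ys)%:R :> R.
Proof.
move=> b0; rewrite -natr_sum ler_nat; elim: ys => [//|y ys IH] h.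
rewrite /cnt /= big_split/= -add1n leq_add//; last by apply: IH => z zs; apply: h; right.
have [j jy] := cube_cellset b0 (h y (or_introl erefl)).
by rewrite (bigD1 j)//= (asboolT jy).
Qed.

(** * The posterior bound *)

Section QuadraticExpectation.
Context {R : realType} {d b : nat}.
Hypothesis b0 : (0 < b)%N.
Variable a : cell d b -> R.
Hypothesis a0 : forall j, 0 < a j.
Let A := \sum_j a j.

Let A0 : 0 < A.
Proof.
have j0 : cell d b := [ffun => Ordinal b0].
by rewrite /A (bigD1 j0)//= ltr_wpDr// sumr_ge0// => m _; exact: ltW.
Qed.

(* [e] is the mean of [U] under the Dirichlet distribution with parameter [a]. *)
Definition is_quad (U : (cell d b -> R) -> R) (e : R) : Prop :=
  exists m : cell d b -> cell d b -> R,
    (forall x, \sum_j x j = 1 -> U x = \sum_i \sum_j m i j * (x i * x j)) /\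
    e = \sum_i \sum_j m i j * dir_moment2 a i j.

(** On the simplex, [c] equals [c] times the squared sum of the coordinates. *)
Lemma is_quad_const c : is_quad (fun _ => c) c.
Proof.
exists (fun _ _ => c); split=> [x x1|].
  under eq_bigr do rewrite -mulr_sumr -mulr_sumr x1 mulr1.
  by rewrite -mulr_sumr x1 mulr1.
by under eq_bigr do rewrite -mulr_sumr; rewrite -mulr_sumr sum_dir_moment2 ?mulr1.
Qed.

Lemma is_quadD U1 U2 e1 e2 : is_quad U1 e1 -> is_quad U2 e2 ->
  is_quad (fun x => U1 x + U2 x) (e1 + e2).
Proof.
move=> [m1 [H1 ->]] [m2 [H2 ->]]; exists (fun i j => m1 i j + m2 i j); split=> [x x1|].
  rewrite H1// H2// -big_split; apply: eq_bigr => i _.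
  by rewrite -big_split/=; apply: eq_bigr => j _; rewrite -mulrDl.
rewrite -big_split; apply: eq_bigr => i _.
by rewrite -big_split/=; apply: eq_bigr => j _; rewrite -mulrDl.
Qed.

Lemma is_quadZ c U e : is_quad U e -> is_quad (fun x => c * U x) (c * e).
Proof.
move=> [m [H ->]]; exists (fun i j => c * m i j); split=> [x x1|].
  rewrite H// mulr_sumr; apply: eq_bigr => i _.
  by rewrite mulr_sumr; apply: eq_bigr => j _; rewrite mulrA.
rewrite mulr_sumr; apply: eq_bigr => i _.
by rewrite mulr_sumr; apply: eq_bigr => j _; rewrite mulrA.
Qed.

Lemma is_quad_sum (I : Type) (r : seq I) U e : (forall i : I, is_quad (U i) (e i)) ->
  is_quad (fun x => \sum_(i <- r) U i x) (\sum_(i <- r) e i).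
Proof.
move=> H; elim: r => [|i r [m [H1 H2]]].
  rewrite big_nil; have [m [H1 H2]] := is_quad_const 0.
  by exists m; split => // x x1; rewrite big_nil; exact: H1.
have [n [K1 K2]] := is_quadD (H i) (ex_intro _ m (conj H1 H2)).
by exists n; split => [x x1|]; rewrite big_cons; [exact: K1|exact: K2].
Qed.

Lemma is_quad_sqr (h : cell d b -> R) : \sum_j h j * a j = 0 ->
  is_quad (fun x => (\sum_j h j * x j) ^+ 2) ((\sum_j h j ^+ 2 * (a j / A)) / (1 + A)).
Proof.
move=> h0; exists (fun i j => h i * h j); split=> [x _|].
  rewrite expr2 mulr_suml; apply: eq_bigr => i _.
  by rewrite mulr_sumr; apply: eq_bigr => j _; ring.
by rewrite dir_moment2_square.
Qed.

Lemma Dirichlet_markov U e (S : set (cell d b -> R)) : is_quad U e ->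
  (forall x, (forall j, 0 < x j) -> \sum_j x j = 1 -> 0 <= U x) ->
  (forall x, (forall j, 0 < x j) -> \sum_j x j = 1 -> S x -> 1 <= U x) ->
  0 <= e -> Dirichlet a S <= e.
Proof.
move=> [m [H ->]] U0 U1 e0; apply: Dirichlet_le_quad => //.
  by move=> x x0 x1; rewrite -H//; exact: U0.
by move=> x x0 x1 Sx; rewrite -H//; exact: U1.
Qed.

End QuadraticExpectation.

Lemma geometric_tail_le (R : realFieldType) (r : R) k K : 0 <= r <= 2^-1 -> (k <= K)%N ->
  \sum_(k <= m < K) r ^+ m <= 2 * r ^+ k.
Proof.
move=> /andP[r0 r2] kK.
(* The subtracted term strengthens the claim enough for induction on [K]. *)
suff : \sum_(k <= m < K) r ^+ m <= 2 * r ^+ k - 2 * r ^+ K.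
  by move=> /le_trans; apply; rewrite gerBl mulr_ge0// exprn_ge0.
elim: K kK => [|K IH]; first by rewrite leqn0 => /eqP ->; rewrite big_geq// subrr.
rewrite leq_eqVlt => /predU1P[->|kK]; first by rewrite big_geq// subrr.
rewrite big_nat_recr//= exprS; have := IH kK; have := exprn_ge0 K r0.
set s := \sum_(_ <= _ < _) _; set x := r ^+ K; nra.
Qed.

(** * Tail bound at a fixed resolution and sample *)

Section PosteriorBound.
Context {R : realType} {d K : nat}.
Local Notation cellK := (cell d (2 ^ K)).
Variables (p v tau : R) (a : cellK -> R) (n : nat).
Hypothesis p0 : 0 < p.
Hypothesis v1 : 1 <= v.
Hypothesis tau0 : 0 < tau.
Hypothesis n0 : (0 < n)%N.
Hypothesis a0 : forall j, 0 < a j.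
Let A := \sum_j a j.
Hypothesis An : n%:R <= A.

Let nu (j : cellK) := a j / A.
Let r : R := 2^-1 `^ v.
Let D0 : R := (d%:R `^ p^-1) `^ v.
Let ck k : R := D0 * r ^+ k.
(** [h ^+ k] is the square root of the number of level-[k] cells. *)
Let h : R := Num.sqrt 2 ^+ d.
Let sn : R := Num.sqrt n%:R.

Let nR : (0 : R) < n%:R. Proof. by rewrite ltr0n. Qed.
Let A0 : 0 < A. Proof. exact: lt_le_trans An. Qed.
Let sn0 : 0 < sn. Proof. by rewrite sqrtr_gt0. Qed.
Let h0 : 0 < h. Proof. by rewrite exprn_gt0// sqrtr_gt0. Qed.
Let sn2 : sn ^+ 2 = n%:R. Proof. by rewrite sqr_sqrtr// ltW. Qed.
Let h2 : h ^+ 2 = 2 ^+ d. Proof. by rewrite exprAC sqr_sqrtr. Qed.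
Let nu0 j : 0 < nu j. Proof. by rewrite divr_gt0. Qed.
Let nu1 : \sum_j nu j = 1. Proof. by rewrite -mulr_suml divff// gt_eqF. Qed.
Let r0 : 0 <= r. Proof. exact: powR_ge0. Qed.
Let r2 : r <= 2^-1.
Proof. by apply: ge1r_powR => //; rewrite invr_gt0 ltr0n invf_le1// ler1n. Qed.
Let D00 : 0 <= D0. Proof. exact: powR_ge0. Qed.
Let ck0 k : 0 <= ck k. Proof. by rewrite mulr_ge0 ?exprn_ge0. Qed.

Let coeff k (i j : cellK) : R :=
  (ancestor k j == ancestor k i)%:R - fmass ancestor nu k i.

(* [|x| <= (x^2 / s + s) / 2] with [s = (h^k sqrt n)^-1], the order of magnitude
   that equalizes the two terms in mean. *)
Let dev k (x : cellK -> R) : R :=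
  2^-1 * \sum_i fweight ancestor nu k i *
    ((h ^+ k * sn) * (\sum_j coeff k i j * x j) ^+ 2 + (h ^+ k * sn)^-1).

Let s0 k : 0 < h ^+ k * sn. Proof. by rewrite mulr_gt0 ?exprn_gt0. Qed.

Let fw0 k i : 0 <= fweight ancestor nu k i.
Proof. exact: fweight_ge0. Qed.

Let dev_ge0 k x : 0 <= dev k x.
Proof.
rewrite mulr_ge0// sumr_ge0// => i _; rewrite mulr_ge0// addr_ge0//.
  by rewrite mulr_ge0 ?sqr_ge0// ltW.
by rewrite invr_ge0 ltW.
Qed.

Let fvar_le_dev k x : fvar ancestor x nu k <= dev k x.
Proof.
rewrite /dev mulr_sumr; apply: ler_sum => i _; rewrite mulrCA ler_wpM2l//.
rewrite /fdiff -/(coeff k i).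
set y := \sum_j _; set s := h ^+ k * sn.
have s0' : 0 < s := s0 k.
rewrite -[in leRHS]real_normK ?num_real//; set z := `|y|.
(* Completing the square: the gap is a nonnegative multiple of a square. *)
have -> : 2^-1 * (s * z ^+ 2 + s^-1) = z + (2 * s)^-1 * (s * z - 1) ^+ 2.
  by field; rewrite gt_eqF.
by rewrite lerDl mulr_ge0 ?sqr_ge0// invr_ge0 mulr_ge0// ltW.
Qed.

Let fmass_coeff k i : \sum_j coeff k i j * a j = 0.
Proof.
have aE j : a j = A * nu j by rewrite /nu mulrC divfK// gt_eqF.
under eq_bigr do rewrite aE mulrCA mulrBl.
rewrite -mulr_sumr sumrB -[X in _ - X]mulr_sumr nu1 mulr1.
rewrite (_ : \sum_j _ = fmass ancestor nu k i) ?subrr ?mulr0//.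
rewrite /fmass [RHS]big_mkcond/=; apply: eq_bigr => j _.
by case: ifP; rewrite ?mul1r ?mul0r.
Qed.

(** Variance of the mass of one cell: the squared centred indicator has [nu]-mean [m - m ^+ 2], and
    [1 + A] exceeds [n]. *)
Let var_le k i : (\sum_j coeff k i j ^+ 2 * (a j / A)) / (1 + A) <=
  fmass ancestor nu k i / n%:R.
Proof.
set m := fmass ancestor nu k i.
have m0 : 0 <= m by apply: sumr_ge0 => j _; exact: ltW.
have mE : \sum_j (ancestor k j == ancestor k i)%:R * nu j = m.
  rewrite /m /fmass [RHS]big_mkcond/=; apply: eq_bigr => j _.
  by case: ifP; rewrite ?mul1r ?mul0r.
have -> : \sum_j coeff k i j ^+ 2 * (a j / A) = m - m ^+ 2.
  transitivity (\sum_j ((1 - 2 * m) * ((ancestor k j == ancestor k i)%:R * nu j) +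
      m ^+ 2 * nu j)).
    apply: eq_bigr => j _; rewrite /coeff -/m -/(nu j).
    by case: (_ == _) => /=; ring.
  by rewrite big_split/= -!mulr_sumr mE nu1; ring.
have m2 := sqr_ge0 m.
apply: (@le_trans _ _ (m / (1 + A))).
  by rewrite ler_pM2r ?invr_gt0 ?addr_gt0//; lra.
rewrite ler_wpM2l// lef_pV2 ?posrE ?addr_gt0//.
by apply: le_trans An _; rewrite lerDr.
Qed.

Lemma card_cell_pow k : #|{: cell d (2 ^ k)}|%:R = (h ^+ k) ^+ 2 :> R.
Proof. by rewrite card_ffun !card_ord exprAC h2 -exprM -expnM natrX mulnC. Qed.

(** The variances contribute at most [h ^+ k / sn] because the cell masses add up to 1, and the
    constant terms at most as much because there are [(h ^+ k) ^+ 2] cells; the factor 1/2 leaves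
    one copy. *)
Let is_quad_dev k : exists2 e, is_quad a (dev k) e & 0 <= e <= h ^+ k / sn.
Proof.
pose V i := (\sum_j coeff k i j ^+ 2 * (a j / A)) / (1 + A).
have V0 i : 0 <= V i.
  apply: divr_ge0; last by rewrite addr_ge0// ltW.
  by apply: sumr_ge0 => j _; rewrite mulr_ge0 ?sqr_ge0// ltW// divr_gt0.
exists (2^-1 * \sum_i fweight ancestor nu k i * ((h ^+ k * sn) * V i + (h ^+ k * sn)^-1)).
  apply: is_quadZ; apply: (is_quad_sum (pow2_gt0 K) a0) => i; apply: is_quadZ; apply: is_quadD.
    by apply: is_quadZ; apply: (is_quad_sqr (pow2_gt0 K) a0); exact: fmass_coeff.
  exact: (is_quad_const (pow2_gt0 K) a0).
have s0' := s0 k.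
apply/andP; split.
  rewrite mulr_ge0// sumr_ge0// => i _; rewrite mulr_ge0// addr_ge0//.
    by rewrite mulr_ge0// ltW.
  by rewrite invr_ge0 ltW.
have -> : h ^+ k / sn = 2^-1 * (h ^+ k * sn / n%:R + (h ^+ k * sn)^-1 * (h ^+ k) ^+ 2).
  rewrite -sn2; field; rewrite !gt_eqF//; exact: exprn_gt0.
rewrite ler_pM2l//; apply: (@le_trans _ _ (\sum_i (h ^+ k * sn / n%:R * nu i +
    (h ^+ k * sn)^-1 * fweight ancestor nu k i))).
  apply: ler_sum => i _; rewrite mulrDr [X in _ + X]mulrC; apply: lerD => //.
  have m0 : 0 < fmass ancestor nu k i.
    by rewrite /fmass (bigD1 i)//= ltr_wpDr// sumr_ge0// => j _; exact: ltW.
  (* The mass in the variance bound cancels the denominator of the weight. *)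
  have -> : h ^+ k * sn / n%:R * nu i =
      fweight ancestor nu k i * (h ^+ k * sn * (fmass ancestor nu k i / n%:R)).
    by rewrite /fweight; field; rewrite !gt_eqF.
  by rewrite ler_wpM2l// ler_wpM2l ?var_le// ltW.
rewrite big_split/= -!mulr_sumr nu1 mulr1 lerD2l.
apply: ler_wpM2l; first by rewrite invr_ge0 ltW.
by rewrite -card_cell_pow; exact: sum_fweight_le.
Qed.

Lemma transport_sym (I : finType) (mu1 mu2 : I -> R) w :
  transport mu1 mu2 w -> transport mu2 mu1 (fun i j => w j i).
Proof. by move=> [w0 w1 w2]; split. Qed.

Let total_ge0 (g : nat -> R) : (forall k, 0 <= g k) ->
  0 <= \sum_(k < K) (2 * ck k) * (g k + g k.+1) + ck K.
Proof.
move=> g0; apply: addr_ge0; last exact: ck0.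
apply: sumr_ge0 => k _; apply: mulr_ge0; last by apply: addr_ge0; exact: g0.
by apply: mulr_ge0 => //; exact: ck0.
Qed.

Let Wass_le_dev (x : cellK -> R) : (forall j, 0 < x j) -> \sum_j x j = 1 ->
  (Wass p v (psi x) (psi nu) <=
   ((\sum_(k < K) (2 * ck k) * (dev k x + dev k.+1 x) + ck K) `^ v^-1)%:E)%E.
Proof.
move=> x0 x1.
have v0 : 0 < v by exact: lt_le_trans ltr01 v1.
have [w [T C]] := @tree_transport R cellK _ (@ancestor d K) K ck
  (fun k i j => @ancestor_refine d K k i j) (@ancestor0 d K) (@ancestor_inj d K)
  ck0 x nu (fun j => ltW (x0 j)) nu0 x1 nu1.
(* The plan goes from [nu] to [x] but the distance is taken from [x] to [nu]; the tree cost is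
   symmetric. *)
have Ts := transport_sym T.
apply: le_trans (Wass_le_cost (pow2_gt0 K) v0 Ts x1
   (fun i j y z iy jz => lpdist_tree_cost p0 (ltW v0) iy jz)) _.
rewrite lee_fin; apply: ge0_ler_powR.
- by rewrite invr_ge0 ltW.
- rewrite nnegrE; apply: sumr_ge0 => i _; apply: sumr_ge0 => j _.
  case: T => w0 _ _; apply: mulr_ge0 => //; apply: addr_ge0; last exact: (ck0 K).
  by apply: sumr_ge0 => k _; apply: mulr_ge0 => //; exact: (ck0 k).
- by rewrite nnegrE; apply: (@total_ge0 (fun k => dev k x)) => k; exact: dev_ge0.
rewrite -/D0 -/r -/ck /cost.
under eq_bigr do under eq_bigr do rewrite mulrDr.
under eq_bigr do rewrite big_split/=.
(* The finest-level term [ck K] is constant, so it is paid once for the total mass 1. *)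
rewrite big_split/=; apply: lerD; last first.
  under eq_bigr do rewrite -mulr_suml.
  by rewrite -mulr_suml; case: Ts => _ t1 _; under eq_bigr do rewrite t1; rewrite x1 mul1r.
apply: le_trans (_ : cost (tree_cost ancestor K ck) w <= _).
  rewrite /cost exchange_big/= le_eqVlt; apply/orP; left; apply/eqP.
  apply: eq_bigr => i _; apply: eq_bigr => j _; congr (_ * _).
  by apply: eq_bigr => k _; rewrite eq_sym.
apply: le_trans C _; apply: ler_sum => k _; apply: ler_pM.
- by apply: sumr_ge0 => m _.
- by rewrite addr_ge0// /fvar sumr_ge0// => i _; rewrite mulr_ge0.
(* Since [r] is at most 1/2, the tail of the level costs is at most twice its first term. *)
- rewrite /ck -mulr_sumr mulrCA ler_wpM2l//.
  by apply: geometric_tail_le; rewrite ?r0//; exact: ltnW.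
- by apply: lerD; exact: fvar_le_dev.
Qed.

(** Markov's inequality for the [v]-th power of the distance, through the quadratic majorant of
    [Wass_le_dev], whose mean is bounded level by level. *)
Lemma Dirichlet_Wass_le :
  Dirichlet a [set x | (tau%:E <= Wass p v (psi x) (psi (fun j => (a j / A)%R)))%E] <=
  (2 * D0 * (1 + h) / sn * \sum_(k < K) (r * h) ^+ k + D0 * r ^+ K) / tau `^ v.
Proof.
have v0 : 0 < v by exact: lt_le_trans ltr01 v1.
have tv : 0 < tau `^ v by exact: powR_gt0.
pose e k := projT1 (cid2 (is_quad_dev k)).
have eq k : is_quad a (dev k) (e k) by rewrite /e; case: cid2.
have e0 k : 0 <= e k by rewrite /e; case: cid2 => ? ? /= /andP[].
have eh k : e k <= h ^+ k / sn by rewrite /e; case: cid2 => ? ? /= /andP[].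
pose U (x : cellK -> R) := (tau `^ v)^-1 *
  (\sum_(k < K) (2 * ck k) * (dev k x + dev k.+1 x) + ck K).
have QU : is_quad a U ((tau `^ v)^-1 *
    (\sum_(k < K) (2 * ck k) * (e k + e k.+1) + ck K)).
  apply: is_quadZ; apply: is_quadD; last exact: (is_quad_const (pow2_gt0 K) a0).
  by apply: (is_quad_sum (pow2_gt0 K) a0) => k; apply: is_quadZ; exact: is_quadD.
apply: le_trans (Dirichlet_markov (pow2_gt0 K) a0 QU _ _ _) _.
- move=> x _ _; apply: mulr_ge0; first by rewrite invr_ge0 ltW.
  by apply: (@total_ge0 (fun k => dev k x)) => k; exact: dev_ge0.
- move=> x x0 x1 /= /le_trans /(_ (Wass_le_dev x0 x1)); rewrite lee_fin => tU.
  set Q := (\sum_(k < K) _ + _) in tU *.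
  have Q0 : 0 <= Q.
    by apply: (@total_ge0 (fun k => dev k x)) => k; exact: dev_ge0.
  rewrite /U -/Q mulrC ler_pdivlMr// mul1r.
  rewrite (_ : Q = (Q `^ v^-1) `^ v); last by rewrite -powRrM mulVf ?gt_eqF// powRr1.
  by apply: ge0_ler_powR; rewrite ?nnegrE ?powR_ge0// ltW.
- by apply: mulr_ge0; [rewrite invr_ge0 ltW|exact: total_ge0].
rewrite mulrC ler_pM2r ?invr_gt0// lerD2r mulr_sumr; apply: ler_sum => k _.
have -> : 2 * D0 * (1 + h) / sn * (r * h) ^+ k =
    2 * ck k * (h ^+ k / sn + h ^+ k.+1 / sn).
  by rewrite /ck exprMn exprS; ring.
apply: ler_wpM2l; first by apply: mulr_ge0 => //; exact: ck0.
by apply: lerD; exact: eh.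
Qed.

End PosteriorBound.

(** * Rates *)

Section Rates.
Context {R : realType}.
Implicit Types x k C c E L : R.

Lemma powR_ge1 x a : 1 <= x -> 0 <= a -> 1 <= x `^ a.
Proof. by move=> x1 a0; rewrite -(powRr0 x) ler_powR. Qed.

Lemma gt1_ltr_powR x : 1 < x -> {homo powR x : a b / a < b}.
Proof.
move=> x1 a b ab; rewrite /powR gt_eqF ?(lt_trans _ x1)// ltr_expR ltr_pM2r//.
exact: ln_gt0.
Qed.

Lemma K_n_bounds (d n : nat) (v : R) (k := k_n d v n) : 1 <= k ->
  k <= 2 ^+ K_n d v n <= 2 * k /\ (K_n d v n)%:R <= ln k / ln 2 + 1.
Proof.
move=> k1; have k0 : 0 < k by exact: lt_le_trans k1.
have l2 : (0 : R) < ln 2 by rewrite ln_gt0// ltr1n.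
have lk : 0 <= ln k by rewrite ln_ge0.
set c := ln k / ln 2; have c0 : 0 <= c by rewrite divr_ge0// ltW.
(* As [k] is at least 1, the ceiling is nonnegative and the absolute value in [K_n] is harmless. *)
have KE : (K_n d v n)%:R = (Num.ceil c)%:~R :> R.
  rewrite /K_n -/k -/c -[in RHS](gez0_abs (_ : 0 <= Num.ceil c))//.
  by rewrite ceil_ge0; exact: lt_le_trans c0.
have /andP[h1 h2] := ceil_itv c; rewrite -KE in h2.
have h3 : (K_n d v n)%:R < c + 1 by rewrite -ltrBlDr KE; move: h1; rewrite intrB.
have pE : 2 ^+ K_n d v n = expR ((K_n d v n)%:R * ln 2) :> R.
  by rewrite expRM_natl lnK// posrE.
split; last exact: ltW.
have cl : c * ln 2 = ln k by rewrite divfK ?gt_eqF.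
have ek : k = expR (ln k) by rewrite lnK ?posrE.
have ek2 : 2 * k = expR (ln 2 + ln k) by rewrite expRD !lnK ?posrE.
rewrite ek2 pE {1}ek !ler_expR -cl ler_pM2r// h2/=.
by rewrite -[X in X + _]mul1r -mulrDl ler_pM2r// addrC ltW.
Qed.

(** The [v]-th power of the threshold has the same power of [x] as the numerator and at least one
    more power of [L], which becomes the factor [L^-1]. *)
Lemma rate_ratio (v gamma' beta' E E' C c L x num : R) : 0 < v -> 0 < C -> 1 <= L -> 0 < x ->
  0 <= c -> beta' + 1 <= gamma' -> E' * v = - E ->
  num <= c * x `^ (- E) * L `^ beta' ->
  num / (C * x `^ E' * L `^ (gamma' / v)) `^ v <= c / C `^ v * L^-1.
Proof.
move=> v0 C0 L1 x0 c0 bg EE' numle; have L0 : 0 < L by exact: lt_le_trans L1.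
have tE : (C * x `^ E' * L `^ (gamma' / v)) `^ v = C `^ v * x `^ (- E) * L `^ gamma'.
  rewrite !powRM ?mulr_ge0 ?powR_ge0 ?ltW//.
  by rewrite -!powRrM EE' divfK ?gt_eqF.
have Cv : 0 < C `^ v by exact: powR_gt0.
have xE : 0 < x `^ (- E) by exact: powR_gt0.
have Lg : 0 < L `^ gamma' by exact: powR_gt0.
rewrite tE ler_pdivrMr; last by rewrite !mulr_gt0.
apply: (le_trans numle).
have -> : c / C `^ v * L^-1 * (C `^ v * x `^ (- E) * L `^ gamma') =
    c * x `^ (- E) * (L `^ gamma' / L) by field; rewrite !gt_eqF.
apply: ler_wpM2l; first by rewrite mulr_ge0// ltW.
rewrite ler_pdivlMr//.
have -> : L `^ beta' * L = L `^ (beta' + 1).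
  by rewrite powRD ?powRr1 ?(ltW L0)//; apply/implyP => _; rewrite gt_eqF.
exact: ler_powR.
Qed.

(** Merges the fluctuation term [S / sn] and the discretization term [rK] into one rate. *)
Lemma numerator_le (D0 h rK sn S E beta' s L x : R) :
  0 <= D0 -> 0 <= h -> 0 <= beta' -> 1 <= L ->
  rK <= x `^ (- E) -> S / sn <= s * x `^ (- E) * L `^ beta' ->
  2 * D0 * (1 + h) / sn * S + D0 * rK <=
  (2 * D0 * (1 + h) * s + D0) * x `^ (- E) * L `^ beta'.
Proof.
move=> D00 h0 b0 L1 hr hS.
have Lb : 1 <= L `^ beta' by exact: powR_ge1.
have -> : 2 * D0 * (1 + h) / sn * S = 2 * D0 * (1 + h) * (S / sn) by ring.
have -> : (2 * D0 * (1 + h) * s + D0) * x `^ (- E) * L `^ beta' =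
   2 * D0 * (1 + h) * (s * x `^ (- E) * L `^ beta') + D0 * (x `^ (- E) * L `^ beta').
  by ring.
apply: lerD.
  by rewrite ler_wpM2l// !mulr_ge0// addr_ge0.
rewrite ler_wpM2l//; apply: (le_trans hr).
by rewrite ler_peMr// powR_ge0.
Qed.

Lemma half_powRX (v : R) K : (2^-1 `^ v) ^+ K = ((2 ^+ K) `^ v)^-1 :> R.
Proof.
rewrite -powR_mulrn ?powR_ge0// powRAC powR_mulrn ?invr_ge0//.
by rewrite exprVn -powRN -[X in X `^ v]powR_inv1 ?exprn_ge0// -powRrM mulN1r.
Qed.

(** The ratio of the geometric series over levels; its position relative to 1 separates the three
    regimes. *)
Lemma half_sqrt_ratio (v : R) (d : nat) :
  2^-1 `^ v * Num.sqrt 2 ^+ d = 2 `^ (d%:R / 2 - v) :> R.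
Proof.
rewrite -powR12_sqrt// -powR_mulrn ?powR_ge0// -powRrM.
rewrite -[X in X `^ v * _]powR_inv1// -powRrM -powRD; last by rewrite pnatr_eq0 implybT.
by congr (_ `^ _); ring.
Qed.

Lemma geometric_le (q : R) K : 0 <= q < 1 -> \sum_(k < K) q ^+ k <= (1 - q)^-1.
Proof.
move=> /andP[q0 q1]; rewrite -[leRHS]mul1r ler_pdivlMr ?subr_gt0// mulrC.
by rewrite -opprB mulNr -subrX1 opprB gerBl exprn_ge0.
Qed.

Lemma geometric_le_gt1 (q : R) K : 1 < q -> \sum_(k < K) q ^+ k <= q ^+ K / (q - 1).
Proof.
by move=> q1; rewrite ler_pdivlMr ?subr_gt0// mulrC -subrX1 gerBl.
Qed.

(** For ratio [q < 1] the series is bounded, for [q > 1] its last term dominates, and for [q = 1]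
    its length gives a logarithm. [M] collects the factors independent of [n]. *)
Lemma posterior_rate (d : nat) (p v gamma C4 C5 C6 : R) :
  (0 < d)%N -> 1 <= v -> 1 < gamma ->
  (d%:R < 2 * v -> 0 < C4) -> (d%:R = 2 * v -> 0 < C5) -> (2 * v < d%:R -> 0 < C6) ->
  exists M : R, forall n : nat, 1 <= ln n%:R :> R ->
    0 < tau_n d v gamma C4 C5 C6 n /\
    (2 * (d%:R `^ p^-1) `^ v * (1 + Num.sqrt 2 ^+ d) / Num.sqrt n%:R *
       (\sum_(k < K_n d v n) (2^-1 `^ v * Num.sqrt 2 ^+ d) ^+ k) +
     (d%:R `^ p^-1) `^ v * (2^-1 `^ v) ^+ K_n d v n) /
    tau_n d v gamma C4 C5 C6 n `^ v <= M * (ln n%:R)^-1.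
Proof.
move=> d0 v1 g1 H4 H5 H6.
have v0 : 0 < v by exact: lt_le_trans v1.
set D0 := (d%:R `^ p^-1) `^ v; have D00 : 0 <= D0 by exact: powR_ge0.
set h : R := Num.sqrt 2 ^+ d; have h0 : 0 <= h by rewrite exprn_ge0.
rewrite half_sqrt_ratio; set q : R := 2 `^ (d%:R / 2 - v).
have q0 : 0 < q by exact: powR_gt0.
have dR : (0 : R) < d%:R by rewrite ltr0n.
have l2 : (0 : R) < ln 2 by rewrite ln_gt0// ltr1n.
have vv : (2 * v)^-1 * v = 2^-1 by field; rewrite gt_eqF.
have basic n : 1 <= ln n%:R :> R -> [/\ (0 : R) < n%:R, 1 <= n%:R :> R &
    0 < ln n%:R :> R].
  move=> L1; have L0 : 0 < ln n%:R :> R by exact: lt_le_trans L1.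
  have n1 : 1 < n%:R :> R by rewrite ltNge; apply/negP => /ln_le0; rewrite leNgt L0.
  by split=> //; [exact: lt_trans n1|exact: ltW].
have rKle n E : 1 <= k_n d v n -> 0 < n%:R :> R -> k_n d v n `^ v = n%:R `^ E ->
    (2^-1 `^ v) ^+ K_n d v n <= n%:R `^ (- E).
  move=> k1 n0 kE; have [/andP[kl _] _] := K_n_bounds k1.
  rewrite half_powRX powRN -kE lef_pV2 ?posrE ?powR_gt0 ?exprn_gt0//; last exact: lt_le_trans k1.
  have k0 : 0 <= k_n d v n by exact: le_trans k1.
  by apply: ge0_ler_powR; rewrite ?nnegrE ?exprn_ge0// ltW.
have snE n : (Num.sqrt n%:R)^-1 = n%:R `^ (- 2^-1) :> R.
  by rewrite powRN powR12_sqrt.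
have [dv|dv|dv] := ltgtP (d%:R : R) (2 * v).
- have q1 : q < 1.
    rewrite /q -[X in _ < X](powRr0 2); apply: gt1_ltr_powR; first by rewrite ltr1n.
    by lra.
  have C0 := H4 dv.
  exists ((2 * D0 * (1 + h) * (1 - q)^-1 + D0) / C4 `^ v) => n L1.
  have [n0 n1 L0] := basic n L1.
  rewrite /tau_n dv; split; first by rewrite !mulr_gt0// powR_gt0.
  have kE : k_n d v n = n%:R `^ (2 * v)^-1 by rewrite /k_n (ltW dv).
  have k1 : 1 <= k_n d v n by rewrite kE powR_ge1// invr_ge0 mulr_ge0// ltW.
  apply: (@rate_ratio _ _ 0 2^-1) => //.
  + rewrite addr_ge0// !mulr_ge0// ?addr_ge0// invr_ge0 subr_ge0 ltW//.
  + by rewrite add0r ltW.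
  + by rewrite mulNr vv.
  apply: numerator_le => //; first by apply: rKle => //; rewrite kE -powRrM vv.
  rewrite powRr0 mulr1 snE ler_wpM2r ?powR_ge0//.
  by apply: geometric_le; rewrite ltW.
- have q1 : 1 < q.
    rewrite /q -[X in X < _](powRr0 2); apply: gt1_ltr_powR; first by rewrite ltr1n.
    by lra.
  have C0 := H6 dv.
  exists ((2 * D0 * (1 + h) * (q / (q - 1)) + D0) / C6 `^ v) => n L1.
  have [n0 n1 L0] := basic n L1.
  rewrite /tau_n (lt_gtF dv) (gt_eqF dv); split; first by rewrite !mulr_gt0// powR_gt0.
  have kE : k_n d v n = n%:R `^ d%:R^-1 by rewrite /k_n (lt_geF dv).
  have k1 : 1 <= k_n d v n by rewrite kE powR_ge1// invr_ge0.
  apply: (@rate_ratio _ _ 0 (d%:R^-1 * v)) => //.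
  + rewrite addr_ge0// !mulr_ge0// ?addr_ge0// ?invr_ge0 ?subr_ge0 ltW//.
  + by rewrite add0r ltW.
  + by rewrite mulNr.
  apply: numerator_le => //; first by apply: rKle => //; rewrite kE -powRrM.
  rewrite powRr0 mulr1 snE.
  apply: le_trans (_ : (q ^+ K_n d v n / (q - 1)) * n%:R `^ (- 2^-1) <= _).
    by rewrite ler_wpM2r ?powR_ge0// geometric_le_gt1.
  (* From [2 ^+ K <= 2 * k_n], raised to the positive power [d / 2 - v]; the rounding factor 2
     becomes [q]. *)
  have qK : q ^+ K_n d v n <= q * n%:R `^ (d%:R^-1 * (d%:R / 2 - v)).
    have [/andP[_ ku] _] := K_n_bounds k1.
    rewrite -powR_mulrn ?powR_ge0// /q powRAC powR_mulrn//.
    have k0 : 0 <= k_n d v n by exact: le_trans k1.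
    rewrite powRrM -kE -powRM//; apply: ge0_ler_powR => //.
    - by rewrite subr_ge0 ler_pdivlMr// mulrC ltW.
    - by rewrite nnegrE exprn_ge0.
    - by rewrite nnegrE mulr_ge0.
  have -> : q / (q - 1) * n%:R `^ (- (d%:R^-1 * v)) =
     q * n%:R `^ (d%:R^-1 * (d%:R / 2 - v)) / (q - 1) * n%:R `^ (- 2^-1).
    (* The growth of the last term times [n^(-1/2)] is exactly the rate [n^(-v/d)]. *)
    have -> : - (d%:R^-1 * v) = d%:R^-1 * (d%:R / 2 - v) + (- 2^-1) :> R.
      by field; rewrite gt_eqF.
    by rewrite powRD; [ring|apply/implyP => _; rewrite gt_eqF].
  rewrite ler_wpM2r ?powR_ge0// ler_wpM2r// invr_ge0 subr_ge0 ltW//.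
- have q1 : q = 1.
    by rewrite /q (_ : d%:R / 2 - v = 0) ?powRr0// dv; field.
  have C0 := H5 dv.
  exists ((2 * D0 * (1 + h) * ((2 * v)^-1 / ln 2 + 1) + D0) / C5 `^ v) => n L1.
  have [n0 n1 L0] := basic n L1.
  rewrite /tau_n dv ltxx eqxx; split; first by rewrite !mulr_gt0// powR_gt0.
  have kE : k_n d v n = n%:R `^ (2 * v)^-1 by rewrite /k_n dv lexx.
  have k1 : 1 <= k_n d v n by rewrite kE powR_ge1// invr_ge0 mulr_ge0// ltW.
  apply: (@rate_ratio _ _ 1 2^-1) => //.
  + by rewrite addr_ge0// !mulr_ge0// ?addr_ge0// ?divr_ge0// ?invr_ge0 ?mulr_ge0// ltW.
  + by rewrite lerD2l ltW.
  + by rewrite mulNr vv.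
  apply: numerator_le => //; first by apply: rKle => //; rewrite kE -powRrM vv.
  rewrite (powRr1 (ltW L0)) snE [X in _ <= X]mulrAC ler_wpM2r ?powR_ge0// q1.
  under eq_bigr do rewrite expr1n.
  (* The sum has [K_n] terms equal to 1, of order [ln n]; the extra 1 from the ceiling is absorbed
     by [1 <= ln n]. *)
  rewrite sumr_const card_ord; have [_] := K_n_bounds k1.
  move=> /le_trans; apply; rewrite kE ln_powR.
  set w := (2 * v)^-1; rewrite mulrDl mul1r.
  by apply: lerD => //; rewrite mulrAC.
Qed.

End Rates.

(** * Convergence of the posterior expectation *)

Lemma Dirichlet_ge0 (R : realType) (d b : nat) (a : cell d b -> R) S :
  0 <= Dirichlet a S.
Proof.
apply: divr_ge0; apply: fine_ge0; apply: iterint_ge0 => s; rewrite lee_fin.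
  by rewrite mulr_ge0// dir_dens_ge0.
exact: dir_dens_ge0.
Qed.

Lemma measurable_cube (R : realType) (d : nat) : measurable (@cube R d : set (Rd R d)).
Proof.
by apply: sub_sigma_algebra; exists (fun _ => `[0, 1[%classic); split.
Qed.

Lemma near_le_ln (R : realType) (B : R) : \forall n \near \oo, B <= ln n%:R.
Proof.
have /cvgryPge/(_ (expR B)) := @cvgr_idn R; apply: filterS => n nB.
rewrite -[B]expRK ler_ln ?posrE ?expR_gt0//.
exact: lt_le_trans (expR_gt0 B) nB.
Qed.

Lemma cvg_inv_ln (R : realType) (M : R) : M * (ln n%:R)^-1 @[n --> \oo] --> (0 : R).
Proof.
apply/cvgrPdist_le => e e0.
have := near_le_ln (Num.max 1 (`|M| / e)); apply: filterS => n.
rewrite ge_max => /andP[L1 Le]; have L0 : 0 < ln n%:R :> R by exact: lt_le_trans L1.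
by rewrite sub0r normrN normrM normfV (gtr0_norm L0) ler_pdivrMr// mulrC -ler_pdivrMr.
Qed.

Theorem theorem2 (R : realType) (d : nat) (p v gamma C1 C2 C3 C4 C5 C6 : R)
  (P0 : probability (Rd R d) R)
  (alpha : forall b : nat, cell d b -> R) :
  (1 <= d)%N -> 1 <= p -> 1 <= v ->
  P0 (@cube R d) = 1%E ->
  (forall n : nat, (1 <= n)%N -> forall j : cell d (b_n d v n), 0 < alpha (b_n d v n) j) ->
  1 < gamma ->
  (d%:R < 2 * v ->
     C1 >= 2 `^ (d%:R / 2 - v) / (1 - 2 `^ (d%:R / 2 - v)) /\
     C4 > 2^-1 * C1 `^ v^-1 * 2 `^ v^-1 * d%:R `^ p^-1) ->
  (d%:R = 2 * v ->
     C2 >= 2 / (d%:R * ln 2) /\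
     C5 > 2^-1 * C2 `^ v^-1 * 2 `^ v^-1 * d%:R `^ p^-1) ->
  (d%:R > 2 * v ->
     C3 >= 2 `^ (2 * (d%:R / 2 - v)) / (2 `^ (d%:R / 2 - v) - 1) /\
     C6 > 2^-1 * C3 `^ v^-1 * 2 `^ v^-1 * d%:R `^ p^-1) ->
  (fun n : nat =>
     iterint P0 n (fun ys =>
       (post_prob p v (alpha (b_n d v n)) (tau_n d v gamma C4 C5 C6 n) ys)%:E))
    @ \oo --> 0%E.
Proof.
move=> d1 p1 v1 P0cube alpha0 g1 H4 H5 H6.
have p0 : 0 < p by exact: lt_le_trans p1.
(* The lower bounds on [C4], [C5], [C6] are nonnegative, so the constant of the regime in force is
   positive. *)
have pos (C : R) : 0 <= 2^-1 * C `^ v^-1 * 2 `^ v^-1 * d%:R `^ p^-1.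
  by rewrite !mulr_ge0// powR_ge0.
have [M HM] := @posterior_rate R d p v gamma C4 C5 C6 d1 v1 g1
  (fun h => le_lt_trans (pos C1) (proj2 (H4 h)))
  (fun h => le_lt_trans (pos C2) (proj2 (H5 h)))
  (fun h => le_lt_trans (pos C3) (proj2 (H6 h))).
apply: (@squeeze_cvge _ _ _ _ (fun _ => 0%E) _
  (fun n => (M * (ln n%:R)^-1)%:E)); last 2 first.
- exact: cvg_cst.
- by apply: cvg_EFin; [exact: nearW|exact: cvg_inv_ln].
have := near_le_ln (1 : R); apply: filterS => n L1.
have n0 : (0 < n)%N.
  by case: n L1 => //; rewrite ln0// ler10.
have [tau0 le_M] := HM n L1.
have post0 ys : (0 <= (post_prob p v (alpha (b_n d v n))
    (tau_n d v gamma C4 C5 C6 n) ys)%:E)%E by rewrite lee_fin Dirichlet_ge0.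
apply/andP; split; first exact: iterint_ge0.
apply: (iterint_le_of_prob1 (@measurable_cube R d)) => // ys yn ycube.
rewrite lee_fin; apply: le_trans le_M.
have a0 j : 0 < alpha_post (alpha (b_n d v n)) ys j.
  by rewrite /alpha_post ltr_wpDr// alpha0.
apply: (Dirichlet_Wass_le p0 v1 tau0 n0 a0).
(* The total concentration is at least [n]: the prior parameters are positive and the counts add up
   to at least [n]. *)
rewrite /alpha_post big_split/= -[X in X <= _]add0r; apply: lerD.
  by apply: sumr_ge0 => j _; exact/ltW/alpha0.
by have := @sum_cnt_ge R d _ ys (pow2_gt0 (K_n d v n)) ycube; rewrite yn.
Qed.
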